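(* Let $\mathbb{F}$ be a field of characteristic $2$. For every $m\in\mathbb{N}$ there is an $\mathbb{F}S_{2m}$-module $E^{(m+1,m-1)}$, which is a non-split extension of $D^{(m+1,m-1)}$ by itself, such that the following hold. For every $n\in\mathbb{N}$ and $k\in\mathbb{Z}$, the $\mathbb{F}S_n$-module $H_k=\ker\epsilon_k/\operatorname{im}\epsilon_{k+2}$ satisfies $$H_k\cong\begin{cases}E^{(m+1,m-1)} & \text{if } n=2m \text{ is even and } k=m,\\ D^{(m+1,m)} & \text{if } n=2m+1 \text{ is odd and } k=m \text{ or } k=m+1,\\ 0 & \text{otherwise.}\end{cases}$$ Moreover, if $n=2m$ or $n=2m+1$, then $H_m$ is the submodule of $\mathbb{F}\Omega_m/\operatorname{im}\epsilon_{m+2}$ generated by $v_m+\operatorname{im}\epsilon_{m+2}$; and for each $m\in\mathbb{N}$ there are isomorphisms $$D^{(m+1,m)}\big\downarrow_{S_{2m}}\cong E^{(m+1,m-1)},\qquad D^{(m+1,m-1)}\big\downarrow_{S_{2m-1}}\cong D^{(m,m-1)}.$$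
   Context: $\mathbb{N}=\{1,2,\dots\}$. $S_n$ is the symmetric group on $\{1,\dots,n\}$, modules are right modules and maps are written on the right. For $k\in\mathbb{Z}$, $\Omega_k$ is the set of $k$-subsets of $\{1,\dots,n\}$ (empty if $k<0$ or $k>n$), and $\mathbb{F}\Omega_k$ is the permutation $\mathbb{F}S_n$-module with basis $\Omega_k$. The two-step boundary map $\epsilon_k:\mathbb{F}\Omega_k\to\mathbb{F}\Omega_{k-2}$ is the $\mathbb{F}S_n$-homomorphism defined by $Y\epsilon_k=\sum_{X\subseteq Y,\,|X|=k-2}X$ for $Y\in\Omega_k$; since $\mathbb{F}$ has characteristic $2$, $\epsilon_{k+2}\epsilon_k=0$. For $\ell\ge 0$ with $2\ell\le n$, $G_\ell=\langle(1,2)\rangle\times\langle(3,4)\rangle\times\cdots\times\langle(2\ell-1,2\ell)\rangle\le S_n$ (trivial if $\ell=0$). For $1\le k$ with $2k\le n$, $v_k=\{2,4,\dots,2k\}\sum_{\sigma\in G_{k-1}}\sigma\in\mathbb{F}\Omega_k$, and $v_0=\varnothing\in\mathbb{F}\Omega_0$. For $2k<n$, $D^{(n-k,k)}$ is the simple $\mathbb{F}S_n$-module labelled by $(n-k,k)$ in James' labelling: identifying the Young permutation module $M^{(n-k,k)}$ with $\mathbb{F}\Omega_k$ (a tabloid goes to the set of entries in its bottom row), the Specht module $S^{(n-k,k)}$ is the submodule of $\mathbb{F}\Omega_k$ generated by $\{2,4,\dots,2k\}\sum_{\sigma\in G_k}\sigma$, and $D^{(n-k,k)}=S^{(n-k,k)}/\bigl(S^{(n-k,k)}\cap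 (S^{(n-k,k)})^{\perp}\bigr)$, where $\perp$ is with respect to the bilinear form for which $\Omega_k$ is orthonormal. Zero parts are allowed, so $D^{(n,0)}$ is the trivial module. $\downarrow$ denotes restriction to the point stabiliser of the largest point. *)

(* Defs.v *)
From mathcomp Require Import all_boot all_order all_algebra.
From mathcomp Require Import all_fingroup all_character.
From mathcomp Require Import zify.
Set Implicit Arguments. Unset Strict Implicit. Unset Printing Implicit Defensive.
Import GroupScope GRing.Theory Num.Theory.
Local Open Scope ring_scope.

(* An FS_n-module of dimension d is an [mx_representation F [set: 'S_n] d]:
   the module is the space 'rV_d of row vectors, on which S_n acts on the right
   (in MathComp, (s * t) x = t (s x)).  Submodules are row spaces, and module
   homomorphisms are matrices acting by right multiplication.
   The points 1, ..., n are the ordinals 0, ..., n - 1: the point j is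
   the ordinal of value j - 1. *)

Section PermutationModule.

Variable n : nat.

Definition Omega (k : int) : {set {set 'I_n}} :=
  [set X : {set 'I_n} | #|X|%:Z == k].

Definition kset (k : int) (i : 'I_#|Omega k|) : {set 'I_n} := enum_val i.

Variable F : fieldType.

(* The basis vector of F Omega_k attached to X; it is 0 if X is not a k-set. *)
Definition basis_vec (k : int) (X : {set 'I_n}) : 'rV[F]_#|Omega k| :=
  \row_j (kset j == X)%:R.

Definition perm_mod_mx (k : int) (s : 'S_n) : 'M[F]_#|Omega k| :=
  \matrix_i basis_vec k [set s x | x in kset i].

Lemma kset_inj k : injective (@kset k).
Proof. exact: enum_val_inj. Qed.

Lemma kset_ex k (X : {set 'I_n}) : X \in Omega k -> exists i, @kset k i = X.
Proof. by move=> kX; exists (enum_rank_in kX X); rewrite /kset enum_rankK_in. Qed.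

Lemma card_kset k (i : 'I_#|Omega k|) : #|kset i|%:Z = k.
Proof. by have := enum_valP i; rewrite inE => /eqP. Qed.

Lemma Omega_perm k (s : 'S_n) (X : {set 'I_n}) :
  ([set s x | x in X] \in Omega k) = (X \in Omega k).
Proof. by rewrite !inE card_imset //; apply: perm_inj. Qed.

Lemma perm_mod_mxE k (s : 'S_n) i j :
  perm_mod_mx k s i j = (kset j == [set s x | x in kset i])%:R.
Proof. by rewrite !mxE. Qed.

Lemma mul_perm_mod_mx k (s : 'S_n) p (A : 'M_(#|Omega k|, p)) i i' j :
  kset i' = [set s x | x in kset i] -> (perm_mod_mx k s *m A) i j = A i' j.
Proof.
move=> Ei'; rewrite mxE (bigD1 i') //= perm_mod_mxE Ei' eqxx mul1r.
rewrite big1 ?addr0 // => l ne_l; rewrite perm_mod_mxE -Ei'.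
by rewrite (inj_eq (@kset_inj _)) (negPf ne_l) mul0r.
Qed.

Lemma kset_perm k (s : 'S_n) (i : 'I_#|Omega k|) :
  exists i' : 'I_#|Omega k|, kset i' = [set s x | x in kset i].
Proof. by apply: kset_ex; rewrite Omega_perm inE card_kset. Qed.

Lemma perm_mod_mx_repr k : mx_repr [set: 'S_n] (perm_mod_mx k).
Proof.
split=> [|s t _ _]; apply/matrixP=> i j.
  rewrite perm_mod_mxE mxE; congr (_ %:R); congr nat_of_bool.
  have -> : [set (1%g : 'S_n) x | x in kset i] = kset i.
    by rewrite -[RHS]imset_id; apply: eq_imset => x; rewrite perm1.
  by rewrite (inj_eq (@kset_inj _)) eq_sym.
have [i' Ei'] := kset_perm s i; rewrite (mul_perm_mod_mx _ _ Ei').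
rewrite !perm_mod_mxE Ei' -imset_comp; congr (_ == _)%:R.
by apply: eq_imset => x; rewrite /= permM.
Qed.

Definition perm_mod (k : int) : mx_representation F [set: 'S_n] #|Omega k| :=
  MxRepresentation (perm_mod_mx_repr k).

(* The matrix of F Omega_j -> F Omega_k sending Y to the sum of the k-subsets
   of Y.  Then [incl_mx k (k - 2)] is epsilon_k and [incl_mx (k + 2) k] is
   epsilon_(k + 2); keeping both degrees as arguments avoids a cast between
   the degrees k + 2 - 2 and k. *)
Definition incl_mx (j k : int) : 'M[F]_(#|Omega j|, #|Omega k|) :=
  \matrix_i \sum_(X in Omega k | X \subset kset i) basis_vec k X.

Definition ker_eps (k : int) : 'M[F]_#|Omega k| := kermx (incl_mx k (k - 2)).
Definition im_eps (k : int) : 'M[F]_#|Omega k| := <<incl_mx (k + 2) k>>%MS.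

Lemma incl_mxE j k i l : incl_mx j k i l = (kset l \subset kset i)%:R.
Proof.
rewrite !mxE summxE; have kl : kset l \in Omega k by rewrite inE card_kset.
have [sli|nsli] := boolP (_ \subset _).
  rewrite (bigD1 (kset l)) ?kl //= mxE eqxx big1 ?addr0 // => X /andP[_ neX].
  by rewrite mxE eq_sym (negPf neX).
rewrite big1 // => X /andP[_ sX]; rewrite mxE; case: eqP => // E.
by rewrite E sX in nsli.
Qed.

Lemma incl_mx_hom j k (s : 'S_n) :
  perm_mod j s *m incl_mx j k = incl_mx j k *m perm_mod k s.
Proof.
apply/matrixP=> i l; have [i' Ei'] := kset_perm s i.
rewrite (mul_perm_mod_mx _ _ Ei') incl_mxE Ei'.
have [l' El'] := kset_perm s^-1%g l.
have El : [set s x | x in kset l'] = kset l.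
  rewrite El' -imset_comp -[RHS]imset_id.
  by apply: eq_imset => x; rewrite /= permKV.
rewrite mxE (bigD1 l') //= incl_mxE perm_mod_mxE El eqxx mulr1 big1 ?addr0.
  rewrite -El; congr (_%:R); congr nat_of_bool.
  apply/idP/idP => [/subsetP sli|]; last exact: imsetS.
  apply/subsetP => x xl; have /imsetP[y yi] := sli _ (imset_f s xl).
  by move/perm_inj->.
move=> r ne_r; rewrite perm_mod_mxE -El eq_sym.
rewrite (inj_eq (imset_inj (@perm_inj _ s))) (inj_eq (@kset_inj _)).
by rewrite (negPf ne_r) mulr0.
Qed.

Lemma ker_eps_module k : mxmodule (perm_mod k) (ker_eps k).
Proof.
apply/mxmoduleP=> s _; apply/sub_kermxP.
by rewrite -mulmxA incl_mx_hom mulmxA mulmx_ker mul0mx.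
Qed.

Lemma im_eps_module k : mxmodule (perm_mod k) (im_eps k).
Proof.
apply/mxmoduleP=> s sG; rewrite (eqmxMr _ (genmxE _)) genmxE.
by rewrite -incl_mx_hom submxMl.
Qed.

Lemma sub_im_ker_eps k : 2%N \in [pchar F] -> (im_eps k <= ker_eps k)%MS.
Proof.
move=> charF2; rewrite genmxE; apply/sub_kermxP/matrixP=> i l; rewrite !mxE.
pose A := [set r : 'I_#|Omega k| | (kset l \subset kset r) && (kset r \subset kset i)].
transitivity (#|A|%:R : F).
  rewrite -(sum1_card (mem A)) natr_sum [RHS]big_mkcond /=; apply: eq_bigr => r _.
  rewrite !incl_mxE inE andbC.
  by case: (_ \subset _); case: (_ \subset _); rewrite ?mul1r ?mul0r.
have [sli|nsli] := boolP (kset l \subset kset i); last first.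
  suff -> : A = set0 by rewrite cards0.
  apply/setP => r; rewrite !inE; apply/negP => /andP[slr sri].
  by rewrite (subset_trans slr sri) in nsli.
have ci := card_kset i; have cl := card_kset l.
have cD : #|kset i :\: kset l| = 4%N.
  rewrite cardsD (setIidPr sli); have := subset_leq_card sli; lia.
suff -> : #|A| = 'C(4, 2).
  by rewrite -[X in X%:R]/(2 * 3)%N natrM (pcharf0 charF2) mul0r.
rewrite -cD -cards_draws.
pose f (r : 'I_#|Omega k|) := kset r :\: kset l.
have inj_f : {in A &, injective f}.
  move=> r1 r2; rewrite !inE => /andP[s1 _] /andP[s2 _] E; apply: kset_inj.
  by rewrite -(setID (kset r1) (kset l)) -(setID (kset r2) (kset l))
             (setIidPr s1) (setIidPr s2) -![_ :\: _]/(f _) E.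
rewrite -(card_in_imset inj_f); congr #|pred_of_set _|; apply/setP => B.
rewrite inE; apply/imsetP/andP=> [[r]|[sB /eqP cB]].
  rewrite inE => /andP[slr sri] ->; split; first exact: setSD.
  rewrite /f cardsD (setIidPr slr); have := card_kset r.
  have := subset_leq_card slr; lia.
have dis : [disjoint B & kset l].
  by move: sB; rewrite subsetD => /andP[].
have [r Er] : exists r : 'I_#|Omega k|, kset r = B :|: kset l.
  apply: kset_ex; rewrite inE cardsU disjoint_setI0 // cards0 subn0; lia.
exists r; rewrite ?inE /f Er ?subsetUr ?subUset ?sli ?andbT /=.
  by apply: subset_trans sB _; apply: subsetDl.
by rewrite setDUl setDv setU0; apply/esym/setDidPl.
Qed.

(* H_k = ker epsilon_k / im epsilon_(k + 2), realised as the image of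
   ker epsilon_k in F Omega_k / im epsilon_(k + 2). *)
Definition homology_sub (k : int) : 'M[F]_(\rank (cokermx (im_eps k))) :=
  <<in_factmod (im_eps k) (ker_eps k)>>%MS.

Definition homology_mod (k : int) :
    mx_representation F [set: 'S_n] (\rank (homology_sub k)) :=
  section_repr (im_eps_module k) (ker_eps_module k).

Definition coker_eps_mod (k : int) :
    mx_representation F [set: 'S_n] (\rank (cokermx (im_eps k))) :=
  factmod_repr (im_eps_module k).

(* <(1,2)> x <(3,4)> x ... x <(2l-1,2l)> and {2, 4, ..., 2k}, in terms of the
   ordinals 0, ..., n - 1. *)
Definition Ggrp (l : nat) : {group 'S_n} :=
  <<[set tperm u.1 u.2 | u : 'I_n * 'I_n &
       [&& ~~ odd u.1, (u.1 < l.*2)%N & u.2 == u.1.+1 :> nat]]>>%G.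

Definition evens (k : nat) : {set 'I_n} := [set x : 'I_n | odd x && (x < k.*2)%N].

Definition Gsum_vec (k l : nat) : 'rV[F]_#|Omega k| :=
  basis_vec k (evens k) *m \sum_(s in Ggrp l) perm_mod k s.

(* For k = 0 this is the basis vector of the empty set, since then k.-1 = 0
   and Ggrp 0 is trivial. *)
Definition v_vec (k : nat) : 'rV[F]_#|Omega k| := Gsum_vec k k.-1.

Definition Specht (k : nat) : 'M[F]_#|Omega k| :=
  cyclic_mx (perm_mod k) (Gsum_vec k k).

(* The orthogonal of the row space U for the form with orthonormal basis
   Omega_k. *)
Definition orth (k : int) (U : 'M[F]_#|Omega k|) : 'M[F]_#|Omega k| :=
  kermx U^T.

Lemma Specht_module (k : nat) : mxmodule (perm_mod k) (Specht k).
Proof. exact: cyclic_mx_module. Qed.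

Lemma perm_mod_tr k (s : 'S_n) : (perm_mod k s)^T = perm_mod k s^-1%g.
Proof.
apply/matrixP=> i j; rewrite mxE !perm_mod_mxE; congr (_%:R); congr nat_of_bool.
apply/eqP/eqP=> ->; rewrite -imset_comp -[LHS]imset_id.
  by apply: eq_imset => x; rewrite /= permK.
by apply: eq_imset => x; rewrite /= permKV.
Qed.

Lemma orth_module k (U : 'M[F]_#|Omega k|) :
  mxmodule (perm_mod k) U -> mxmodule (perm_mod k) (orth U).
Proof.
move=> modU; apply/mxmoduleP=> s _; apply/sub_kermxP.
have /submxP[D ED] : (U *m perm_mod k s^-1%g <= U)%MS.
  by apply: (mxmoduleP modU); rewrite inE.
rewrite -mulmxA -[perm_mod k s]trmxK perm_mod_tr -trmx_mul ED.
by rewrite trmx_mul mulmxA mulmx_ker mul0mx.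
Qed.

Lemma Specht_rad_module (k : nat) :
  mxmodule (perm_mod k) (Specht k :&: orth (Specht k))%MS.
Proof.
by apply: capmx_module; [|apply: orth_module]; apply: Specht_module.
Qed.

(* D^(n-k,k), for 2k < n. *)
Definition D_mod (k : nat) : mx_representation F [set: 'S_n]
    (\rank <<in_factmod (Specht k :&: orth (Specht k)) (Specht k)>>)%MS :=
  section_repr (Specht_rad_module k) (Specht_module k).

End PermutationModule.

Section Restriction.

Variables (F : fieldType) (n d : nat).
Variable rM : mx_representation F [set: 'S_n.+1] d.

Let down (s : 'S_n) : 'M[F]_d := rM (lift_perm ord_max ord_max s).

Lemma res_mx_repr : mx_repr [set: 'S_n] down.
Proof.
split=> [|s t _ _]; first by rewrite /down lift_perm1 repr_mx1.
by rewrite /down -(lift_permM _ ord_max) repr_mxM ?inE.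
Qed.

(* S_n is embedded in S_(n+1) as the stabiliser of the largest point. *)
Definition res_mod : mx_representation F [set: 'S_n] d :=
  MxRepresentation res_mx_repr.

End Restriction.

Section Modules.

Variables (F : fieldType) (gT : finGroupType) (G : {group gT}).

Lemma zero_mx_repr : mx_repr G (fun _ : gT => 0 : 'M[F]_0).
Proof. by split=> [|x y _ _]; apply: flatmx0 || rewrite !flatmx0. Qed.

Definition zero_mod : mx_representation F G 0 := MxRepresentation zero_mx_repr.

(* E is a non-split extension of B by A: there is an exact sequence
   0 -> A -> E -> B -> 0, and the image of A has no complement in E. *)
Definition nonsplit_extension dE dA dB (rE : mx_representation F G dE)
    (rB : mx_representation F G dB) (rA : mx_representation F G dA) : Prop :=
  exists (U : 'M[F]_dE) (modU : mxmodule rE U),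
    [/\ mx_rsim (submod_repr modU) rA, mx_rsim (factmod_repr modU) rB
      & mxsplits rE 1%:M U -> False].

End Modules.

(* Main.v *)
From HB Require Import structures.
Require Import Defs.
From mathcomp Require Import all_boot all_order all_algebra.
From mathcomp Require Import all_fingroup all_character.
From mathcomp Require Import zify.
From mathcomp Require cyclic.
Set Implicit Arguments. Unset Strict Implicit. Unset Printing Implicit Defensive.
Import GroupScope GRing.Theory Num.Theory.
Local Open Scope ring_scope.

(* Regard F Omega_* as the algebra F[x_1, ..., x_n]/(x_i^2), with delta and
   epsilon the first and second elementary symmetric functions of the partial
   derivatives.  Cancelling x_a x_b f against f shows that the homology on n
   points in degree k is two copies of the homology on n - 2 points in degree
   k - 1.  This gives the vanishing, the generation by v_m, and the fact that
   the elementary abelian group generated by m disjoint transpositions acts on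
   H_m as on its regular module, with socle spanned by the polytabloid
   (x_1 + x_2) ... (x_(2m-1) + x_(2m)).

   For n = 2m + 1, polytabloids are orthogonal to boundaries, and every
   submodule of the middle homology contains the polytabloid, so a Specht
   vector is a boundary if and only if it is orthogonal to the Specht module;
   this identifies H_m with D^(m+1,m).  The isomorphisms between homologies and
   the restrictions come from splitting off one point.  For n = 2m, if epsilon g
   is in S^(m+1,m-1) then delta g is a cycle, and epsilon g -> delta g embeds
   D^(m+1,m-1) into H_m; its image U is generated by the polytabloid, hence is
   essential, while delta induces H_m / U = D^(m+1,m-1). *)

(** The cancellation works because epsilon contains the product of the partial derivatives at [a]
    and [b], which carries x_a x_b f to f. Modulo boundaries the part of a cycle free of both
    variables disappears, the coefficient of x_a x_b is then forced, and only the coefficients of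
    x_a and x_b survive. Twice the degree minus the number of points is unchanged, so everything
    ends on at most one point. The obstacle is an even number 2m > 0 of points: two polytabloids on
    all of them have an even number of common transversals, so in the middle degree they are
    orthogonal although none of them bounds. The way out is that an element y with delta y = 0
    equals y0 + x_a delta y0 with y0 free of x_a, and that y -> y0 commutes with epsilon on such
    elements. This moves the question to 2m - 1 points, where orthogonality detects boundaries. *)

Section CharTwoSums.

Variables (F : fieldType) (V : lmodType F).
Hypothesis charF : 2%N \in [pchar F].

Lemma addv2 (x : V) : x + x = 0.
Proof. by rewrite -mulr2n -scaler_nat (pcharf0 charF) scale0r. Qed.

Lemma eq_of_add2 (x y : V) : x + y = 0 -> x = y.
Proof. by move=> xy0; rewrite -[x]addr0 -(addv2 y) addrA xy0 add0r. Qed.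

Lemma subv2 (x y : V) : x - y = x + y.
Proof. by rewrite -[x in RHS](subrK y) -addrA addv2 addr0. Qed.

Lemma add2_move (x y z : V) : x + y = z -> y = x + z.
Proof. by move=> <-; rewrite addrA addv2 add0r. Qed.

(** Reflection step of the [char2] tactic: [l] lists the atoms, [s] their occurrences, and the
    parity of each count is decided by computation. *)
Lemma sum_even_mult (l : seq V) (s : seq nat) :
  all (fun i => ~~ odd (count_mem i s)) s ->
  foldr (fun i x => nth 0 l i + x) 0 s = 0.
Proof.
move=> /allP ev; have -> : foldr (fun i x => nth 0 l i + x) 0 s = \sum_(i <- s) nth 0 l i.
  by elim: s {ev} => [|i s IH]; rewrite ?big_nil ?big_cons //= IH.
rewrite -big_undup_iterop_count big1_seq // => i /=.
rewrite mem_undup => /ev ec; rewrite -/((nth 0 l i) *+ (count_mem i s)).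
by rewrite -[count_mem i s]odd_double_half (negPf ec) -mul2n mulrnA mulr2n addv2 mul0rn.
Qed.

End CharTwoSums.

Ltac add_atom t l :=
  match l with
  | nil => constr:([:: t])
  | t :: _ => l
  | ?u :: ?l1 => let l2 := add_atom t l1 in constr:(u :: l2)
  end.
Ltac sum_atoms t l :=
  match t with
  | (?a + ?b)%R => let l1 := sum_atoms a l in sum_atoms b l1
  | _ => add_atom t l
  end.
Ltac atom_index t l :=
  match l with
  | t :: _ => constr:(0%N)
  | _ :: ?l1 => let i := atom_index t l1 in constr:(i.+1)
  end.
Ltac sum_indices t l acc :=
  match t with
  | (?a + ?b)%R =>
      let acc1 := sum_indices b l acc in sum_indices a l acc1
  | _ => let i := atom_index t l in constr:(i :: acc)
  end.
(* Proves an equality of sums up to the vanishing of [x + x]. *)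
Ltac char2 charF :=
  apply: (eq_of_add2 charF); rewrite /= ?(add0r, addr0);
  match goal with
  | |- @eq ?V ?t _ =>
    let l := sum_atoms t (@nil V) in
    let s := sum_indices t l (@nil nat) in
    let H := fresh in
    have H := @sum_even_mult _ _ charF l s isT;
    cbv [foldr nth] in H; rewrite addr0 ?addrA in H; rewrite ?addrA; exact: H
  end.

(** * Square-free polynomials and their derivations *)

Section Operators.

Variables (F : fieldType) (T : finType).

Local Notation Lam := {ffun {set T} -> F^o}.

Definition lam1 : Lam := [ffun X : {set T} => (X == set0)%:R].

(* On the square-free algebra F[x_t | t : T]/(x_t^2), whose monomials are the
   subsets of T, [pd a] is the partial derivative with respect to x_a and
   [xm a] is the multiplication by x_a. *)
Definition pd (a : T) (f : Lam) : Lam :=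
  [ffun X : {set T} => if a \in X then 0 else f (a |: X)].
Definition xm (a : T) (f : Lam) : Lam :=
  [ffun X : {set T} => if a \in X then f (X :\ a) else 0].

Lemma pd_is_linear a : linear (pd a).
Proof.
move=> c f g; apply/ffunP=> X; rewrite !ffunE.
by case: ifP => _ //; rewrite scaler0 addr0.
Qed.
HB.instance Definition _ a := GRing.isLinear.Build F Lam Lam _ (pd a) (pd_is_linear a).

Lemma xm_is_linear a : linear (xm a).
Proof.
move=> c f g; apply/ffunP=> X; rewrite !ffunE.
by case: ifP => _ //; rewrite scaler0 addr0.
Qed.
HB.instance Definition _ a := GRing.isLinear.Build F Lam Lam _ (xm a) (xm_is_linear a).

(** A recursion on a list makes splitting off one point definitional; [perm_del] and [perm_eps]
    supply the independence of the order. *)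
Fixpoint del (s : seq T) (f : Lam) : Lam :=
  if s is a :: s' then del s' f + pd a f else 0.

(* The second elementary symmetric function of the derivations in s. *)
Fixpoint eps (s : seq T) (f : Lam) : Lam :=
  if s is a :: s' then eps s' f + pd a (del s' f) else 0.

Lemma del_is_linear s : linear (del s).
Proof.
elim: s => [|a s IH] c f g /=; first by rewrite scaler0 addr0.
by rewrite IH linearP scalerDr addrACA.
Qed.
HB.instance Definition _ s := GRing.isLinear.Build F Lam Lam _ (del s) (del_is_linear s).

Lemma eps_is_linear s : linear (eps s).
Proof.
elim: s => [|a s IH] c f g /=; first by rewrite scaler0 addr0.
by rewrite IH !linearP scalerDr addrACA.
Qed.
HB.instance Definition _ s := GRing.isLinear.Build F Lam Lam _ (eps s) (eps_is_linear s).

Lemma pd_pd a f : pd a (pd a f) = 0.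
Proof. by apply/ffunP=> X; rewrite !ffunE setU11 if_same. Qed.

Lemma pdC a b f : pd a (pd b f) = pd b (pd a f).
Proof.
have [->//|nab] := eqVneq a b.
apply/ffunP=> X; rewrite !ffunE !inE eq_sym (negPf nab) /=.
by case: ifP; case: ifP => // _ _; rewrite setUCA.
Qed.

Lemma xmC a b f : xm a (xm b f) = xm b (xm a f).
Proof.
have [->//|nab] := eqVneq a b.
apply/ffunP=> X; rewrite !ffunE !inE [b == a]eq_sym nab /=.
case: ifP; case: ifP => // _ _; congr (f _).
by apply/setP=> x; rewrite !inE andbCA.
Qed.

(** Each monomial is fixed by one of the two composites and killed by the other, so this holds in
    every characteristic. *)
Lemma pd_xm a f : pd a (xm a f) + xm a (pd a f) = f.
Proof.
apply/ffunP=> X; rewrite !ffunE setU11 setD11.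
case: ifP => aX; first by rewrite setD1K ?add0r.
by rewrite addr0 setU1K // aX.
Qed.

Lemma pd_xm_neq a b f : a != b -> pd a (xm b f) = xm b (pd a f).
Proof.
move=> nab; apply/ffunP=> X; rewrite !ffunE !inE [b == a]eq_sym (negPf nab) /=.
case: ifP; case: ifP => // _ _; congr (f _).
apply/setP=> x; rewrite !inE; case: (x =P a) => //= ->.
by rewrite nab.
Qed.

Lemma pd_one a : pd a lam1 = 0.
Proof.
apply/ffunP=> X; rewrite !ffunE; case: ifP => // _.
by case: eqP => // E; have := setU11 a X; rewrite E inE.
Qed.

Lemma pd_del a s f : pd a (del s f) = del s (pd a f).
Proof. by elim: s => [|b s IH] /=; rewrite ?linear0 // linearD /= IH pdC. Qed.

Lemma pd_eps a s f : pd a (eps s f) = eps s (pd a f).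
Proof.
by elim: s => [|b s IH] /=; rewrite ?linear0 // linearD /= IH pdC pd_del.
Qed.

Lemma del_eps s t f : del s (eps t f) = eps t (del s f).
Proof. by elim: s => [|b s IH] /=; rewrite ?linear0 // linearD /= IH pd_eps. Qed.

Lemma del_cat s t f : del (s ++ t) f = del s f + del t f.
Proof. by elim: s => [|a s IH] /=; rewrite ?add0r // IH addrAC. Qed.

Lemma eps_cat s t f : eps (s ++ t) f = eps s f + eps t f + del s (del t f).
Proof.
elim: s => [|a s IH] /=; first by rewrite add0r addr0.
by rewrite IH del_cat linearD /= !addrA [LHS](ACl (1*4*2*3*5)).
Qed.

Lemma perm_del s t : perm_eq s t -> del s =1 del t.
Proof.
move=> st f; have E u : del u f = \sum_(a <- u) pd a f.
  by elim: u => [|a u IH]; rewrite ?big_nil ?big_cons //= IH addrC.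
by rewrite !E; apply: perm_big.
Qed.

Lemma perm_eps s t : perm_eq s t -> eps s =1 eps t.
Proof.
move=> st f; elim: s t st => [|a s IH] t st.
  by move: st; rewrite perm_sym => /perm_nilP->.
have at_ : a \in t by rewrite -(perm_mem st) mem_head.
case/splitPr: at_ st => t1 t2.
rewrite perm_sym -[a :: t2]cat1s perm_catCA /= perm_cons perm_sym => st.
rewrite /= (IH _ st) (perm_del st) del_cat !eps_cat /= !linearD /= -pd_del.
by rewrite !addrA [RHS](ACl (1*2*4*5*3)).
Qed.

Section Char2.

Hypothesis charF : 2%N \in [pchar F].

(** The derivations commute and square to zero, so the square of e_1 is 2 e_2 here, and the square
    of e_2 is 6 e_4 in [eps2]. *)
Lemma del2 s f : del s (del s f) = 0.
Proof.
elim: s => [|a s IH] //=; rewrite !linearD /= -pd_del IH pd_pd pd_del.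
by char2 charF.
Qed.

Lemma eps2 s f : eps s (eps s f) = 0.
Proof.
elim: s => [|a s IH] //=.
rewrite !linearD /= IH -!pd_eps del_eps -pd_del pd_pd.
by char2 charF.
Qed.

Lemma del_xm_notin s a f : a \notin s -> del s (xm a f) = xm a (del s f).
Proof.
elim: s => [|b s IH] /=; first by rewrite linear0.
rewrite inE negb_or eq_sym => /andP[nab nas].
by rewrite IH // pd_xm_neq // linearD.
Qed.

Lemma eps_xm_notin s a f : a \notin s -> eps s (xm a f) = xm a (eps s f).
Proof.
elim: s => [|b s IH] /=; first by rewrite linear0.
rewrite inE negb_or eq_sym => /andP[nab nas].
by rewrite IH // del_xm_notin // pd_xm_neq // linearD.
Qed.

Lemma pd_xmE a f : pd a (xm a f) = f + xm a (pd a f).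
Proof. by rewrite -{2}(pd_xm a f); char2 charF. Qed.

Lemma del_xm s a f : uniq s -> a \in s -> del s (xm a f) = xm a (del s f) + f.
Proof.
move=> us a_s; have ps := perm_to_rem a_s; rewrite !(perm_del ps) /=.
rewrite del_xm_notin ?mem_rem_uniqF // pd_xmE linearD.
by char2 charF.
Qed.

(** The commutator of e_2 with x_a is the sum of the derivations other than [pd a], which is
    [del s + pd a] in characteristic 2. *)
Lemma eps_xm s a f : uniq s -> a \in s ->
  eps s (xm a f) = xm a (eps s f) + del s f + pd a f.
Proof.
move=> us a_s; have ps := perm_to_rem a_s.
rewrite !(perm_del ps) !(perm_eps ps) /=.
have na : a \notin rem a s by rewrite mem_rem_uniqF.
rewrite del_xm_notin // eps_xm_notin // pd_xmE linearD /= pd_del.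
by char2 charF.
Qed.

End Char2.
End Operators.

(** * Homology of the two-step boundary map *)

Section Cycles.

Variables (F : fieldType) (T : finType).
Local Notation Lam := {ffun {set T} -> F^o}.
Local Notation D := (@del F T (enum T)).
Local Notation E := (@eps F T (enum T)).
Implicit Types (f g h : Lam) (s : seq T) (a b : T) (c : F) (k : int).

Lemma del_one s : del s (lam1 F T) = 0.
Proof. by elim: s => //= a s ->; rewrite pd_one addr0. Qed.

Lemma eps_one s : eps s (lam1 F T) = 0.
Proof. by elim: s => //= a s ->; rewrite del_one linear0 addr0. Qed.

(** The subalgebra on the points of [s]. Subsets of the points are treated inside one fixed algebra,
    so inductions on [s] keep the same operators; by [eps_supp], [E] acts on this subalgebra as
    [eps s]. *)
Definition supp s f := forall a, a \notin s -> pd a f = 0.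
Definition homog k f := forall X : {set T}, f X != 0 -> #|X|%:Z = k.

Lemma supp0 s : supp s 0.
Proof. by move=> a _; rewrite linear0. Qed.

Lemma suppD s f g : supp s f -> supp s g -> supp s (f + g).
Proof. by move=> sf sg a na; rewrite linearD /= sf // sg // addr0. Qed.

Lemma supp_del s t f : supp s f -> supp s (del t f).
Proof. by move=> sf a na; rewrite pd_del sf // linear0. Qed.

Lemma supp_eps s t f : supp s f -> supp s (eps t f).
Proof. by move=> sf a na; rewrite pd_eps sf // linear0. Qed.

Lemma supp_xm s a f : a \in s -> supp s f -> supp s (xm a f).
Proof.
move=> sa sf b nb; rewrite pd_xm_neq ?sf ?linear0 //.
by apply: contraNneq nb => ->.
Qed.

Lemma supp_sub s t f : {subset s <= t} -> supp s f -> supp t f.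
Proof. by move=> st sf a na; apply: sf; apply: contra na; apply: st. Qed.

Lemma supp_cons a s f : supp s f -> supp (a :: s) f.
Proof. by apply: supp_sub => b sb; rewrite inE sb orbT. Qed.

Lemma supp_one s : supp s (lam1 F T).
Proof. by move=> a _; rewrite pd_one. Qed.

Lemma supp_enum f : supp (enum T) f.
Proof. by move=> a; rewrite mem_enum. Qed.

Lemma supp_pd a s f : supp (a :: s) f -> supp s (pd a f).
Proof.
move=> sf b nb; have [->|nab] := eqVneq b a; first by rewrite pd_pd.
by rewrite pdC sf ?linear0 // inE negb_or nab.
Qed.

Lemma supp_pd_xm a s f : supp (a :: s) f -> supp s (pd a (xm a f)).
Proof.
move=> sf b nb; have [->|nab] := eqVneq b a; first by rewrite pd_pd.
by rewrite pdC pd_xm_neq // sf ?linear0 // inE negb_or nab.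
Qed.

Lemma eps_supp s f : uniq s -> supp s f -> E f = eps s f.
Proof.
move=> us sf.
have p : perm_eq (enum T) (s ++ [seq x <- enum T | x \notin s]).
  apply: uniq_perm; rewrite ?enum_uniq //.
    rewrite cat_uniq us filter_uniq ?enum_uniq // andbT.
    by apply/hasPn => x; rewrite mem_filter => /andP[].
  by move=> x; rewrite mem_cat mem_filter mem_enum inE andbT orbN.
have d0 t : {in t, forall x, x \notin s} -> del t f = 0 /\ eps t f = 0.
  elim: t => //= a t IH st; have [|-> ->] := IH.
    by move=> x xt; apply: st; rewrite inE xt orbT.
  by rewrite linear0 sf ?addr0 // st ?mem_head.
have [|d1 e1] := d0 [seq x <- enum T | x \notin s].
  by move=> x; rewrite mem_filter => /andP[].
by rewrite (perm_eps p) eps_cat d1 e1 linear0 !addr0.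
Qed.

Lemma pd0_val a f (X : {set T}) : pd a f = 0 -> a \in X -> f X = 0.
Proof.
move/ffunP/(_ (X :\ a)); rewrite !ffunE setD11 => f0 aX.
by rewrite setD1K in f0.
Qed.

Lemma homog0 k : homog k 0.
Proof. by move=> X; rewrite ffunE eqxx. Qed.

Lemma homogD k f g : homog k f -> homog k g -> homog k (f + g).
Proof.
move=> hf hg X; rewrite ffunE; have [f0|nf _] := eqVneq (f X) 0.
  by rewrite f0 add0r; apply: hg.
exact: hf.
Qed.

Lemma homogZ k c f : homog k f -> homog k (c *: f).
Proof.
by move=> hf X; rewrite ffunE => nz; apply: hf; apply: contraNneq nz => ->; rewrite scaler0.
Qed.

Lemma homog_pd a k k' f : k' = k - 1 -> homog k f -> homog k' (pd a f).
Proof.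
move=> -> hf X; rewrite ffunE; case: ifP => [|nX /hf]; first by rewrite eqxx.
by rewrite cardsU1 nX /=; lia.
Qed.

Lemma homog_xm a k k' f : k' = k + 1 -> homog k f -> homog k' (xm a f).
Proof.
move=> -> hf X; rewrite ffunE; case: ifP => [aX /hf|]; last by rewrite eqxx.
by rewrite (cardsD1 a X) aX /=; lia.
Qed.

Lemma homog_del s k k' f : k' = k - 1 -> homog k f -> homog k' (del s f).
Proof.
move=> ek hf; elim: s => [|a s IH] /=; first exact: homog0.
by apply: homogD => //; apply: homog_pd hf.
Qed.

Lemma homog_eps s k k' f : k' = k - 2 -> homog k f -> homog k' (eps s f).
Proof.
move=> ek hf; elim: s => [|a s IH] /=; first exact: homog0.
by apply: homogD => //; apply: (@homog_pd _ (k - 1)); [lia | apply: homog_del hf].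
Qed.

Lemma homog_one : homog 0 (lam1 F T).
Proof. by move=> X; rewrite ffunE; case: (X =P set0) => [->|] //=; rewrite ?cards0 ?eqxx. Qed.

Lemma homog0E f : homog 0 f -> f = f set0 *: lam1 F T.
Proof.
move=> hf; apply/ffunP => X; rewrite !ffunE; case: (X =P set0) => [->|nX].
  by rewrite [_ *: _]mulr1.
rewrite scaler0; apply/eqP; apply: contra_notT nX => /hf.
by move/eqP; rewrite eqz_nat cards_eq0 => /eqP.
Qed.

Lemma supp_card s f (X : {set T}) : supp s f -> f X != 0 -> (#|X| <= size s)%N.
Proof.
move=> sf nX; apply: leq_trans (card_size s); apply: subset_leq_card.
apply/subsetP=> a aX; apply: contraNT nX => na.
by rewrite (pd0_val (sf _ na) aX).
Qed.

Hypothesis charF : 2%N \in [pchar F].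

Lemma delF2 f : D (D f) = 0. Proof. exact: del2. Qed.
Lemma epsF2 f : E (E f) = 0. Proof. exact: eps2. Qed.

Lemma delF_xm a f : D (xm a f) = xm a (D f) + f.
Proof. by rewrite del_xm ?enum_uniq ?mem_enum. Qed.

Lemma epsF_xm a f : pd a f = 0 -> E (xm a f) = xm a (E f) + D f.
Proof. by move=> f0; rewrite eps_xm ?enum_uniq ?mem_enum // f0 addr0. Qed.

Lemma xm_split0 a f0 f1 : pd a f0 = 0 -> pd a f1 = 0 -> f0 + xm a f1 = 0 ->
  f0 = 0 /\ f1 = 0.
Proof.
move=> p0 p1 e; have f10 : f1 = 0.
  have := congr1 (pd a) e; rewrite linearD linear0 /= p0 add0r.
  by rewrite pd_xmE // p1 linear0 addr0.
by move: e; rewrite f10 linear0 addr0.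
Qed.

Definition bounds s k f := exists h, [/\ supp s h, homog (k + 2) h & f = E h].

Lemma bounds0 s k : bounds s k 0.
Proof. by exists 0; rewrite linear0; split=> //; [apply: supp0 | apply: homog0]. Qed.

Lemma boundsD s k f g : bounds s k f -> bounds s k g -> bounds s k (f + g).
Proof.
move=> [h [sh hh ->]] [h' [sh' hh' ->]]; exists (h + h').
by rewrite linearD; split=> //; [apply: suppD | apply: homogD].
Qed.

(* A chain map of degree 1; the classes of [zmap a b f] and [zmap b a f], for f
   running over the homology on the points other than a and b, span the
   homology. *)
Definition zmap a b f := xm a f + xm a (xm b (D f)).

Lemma zmap_is_linear a b : linear (zmap a b).
Proof. by move=> c f g; rewrite /zmap !linearP scalerDr addrACA. Qed.
HB.instance Definition _ a b := GRing.isLinear.Build F Lam Lam _ (zmap a b) (zmap_is_linear a b).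

Lemma epsF_xm2 a b f : a != b -> pd a f = 0 -> pd b f = 0 ->
  E (xm a (xm b f)) = xm a (xm b (E f)) + xm a (D f) + xm b (D f) + f.
Proof.
move=> nab a0 b0; rewrite epsF_xm ?epsF_xm // ?delF_xm ?linearD /=.
  by char2 charF.
by rewrite pd_xm_neq // a0 linear0.
Qed.

Lemma eps_zmap a b f : a != b -> pd a f = 0 -> pd b f = 0 ->
  E (zmap a b f) = zmap a b (E f).
Proof.
move=> nab a0 b0; rewrite /zmap linearD /= epsF_xm // epsF_xm2 //.
  by rewrite delF2 !linear0 del_eps; char2 charF.
all: by rewrite pd_del ?a0 ?b0 linear0.
Qed.

Lemma bounds_zmap a b s k k' f : k = k' + 1 -> uniq (a :: b :: s) -> bounds s k' f ->
  bounds (a :: b :: s) k (zmap a b f).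
Proof.
move=> -> /=; rewrite inE negb_or -andbA => /and4P[nab nas nbs _] [h [sh hh ->]].
exists (zmap a b h); split; last by rewrite eps_zmap ?sh.
  have sh2 g : supp s g -> supp (a :: b :: s) g by move=> sg; do 2!apply: supp_cons.
  apply: suppD; first by apply: supp_xm (sh2 _ sh); rewrite inE eqxx.
  apply: supp_xm; first by rewrite inE eqxx.
  by apply: supp_xm; [rewrite !inE eqxx orbT | apply/sh2/supp_del].
apply: homogD; first by apply: homog_xm hh; lia.
apply: (@homog_xm _ (k' + 2)); first lia.
apply: (@homog_xm _ (k' + 1)); first lia.
by apply: homog_del hh; lia.
Qed.

(** With f = p0 + x_b p2 + x_a p1 + x_a x_b p3, adding the boundary of x_a x_b p0 cancels p0, and
    the cycle condition then leaves p1 and p2 as the only free data. *)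
Lemma cycle_zmap a b s k f : uniq (a :: b :: s) ->
    supp (a :: b :: s) f -> homog k f -> E f = 0 ->
  exists f1 f2 h, [/\ [/\ supp s f1, homog (k - 1) f1 & E f1 = 0],
    [/\ supp s f2, homog (k - 1) f2 & E f2 = 0],
    supp (a :: b :: s) h /\ homog (k + 2) h
    & f = zmap a b f1 + zmap b a f2 + E h].
Proof.
move=> /=; rewrite inE negb_or -andbA => /and4P[nab nas nbs us] sf hf Ef.
set q0 := pd a (xm a f); set q1 := pd a f.
have sq0 : supp (b :: s) q0 by apply: supp_pd_xm.
have sq1 : supp (b :: s) q1 by apply: supp_pd.
have hq1 : homog (k - 1) q1 by apply: homog_pd hf.
have hq0 : homog k q0.
  by apply: (@homog_pd _ (k + 1)); [lia | apply: homog_xm hf].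
set p0 := pd b (xm b q0); set p2 := pd b q0.
set p1 := pd b (xm b q1); set p3 := pd b q1.
have [s0 s1 s2 s3] : [/\ supp s p0, supp s p1, supp s p2 & supp s p3].
  by split; [apply: supp_pd_xm | apply: supp_pd_xm | apply: supp_pd | apply: supp_pd].
have hp0 : homog k p0.
  by apply: (@homog_pd _ (k + 1)); [lia | apply: homog_xm hq0].
have hp1 : homog (k - 1) p1.
  by apply: (@homog_pd _ k); [lia | apply: homog_xm hq1; lia].
have hp2 : homog (k - 1) p2 by apply: homog_pd hq0.
have fE : f = p0 + xm b p2 + xm a (p1 + xm b p3).
  by rewrite /p0 /p1 /p2 /p3 !pd_xm.
(* The coefficients of 1, x_b, x_a and x_a x_b in [E f], separated in two rounds. *)
have [z1 z2] : E p0 + D p1 + D p2 + p3 + xm b (E p2 + D p3) = 0 /\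
    (E p1 + D p3) + xm b (E p3) = 0.
  have supp_out g1 g2 : supp s g1 -> supp s g2 -> pd a (g1 + xm b g2) = 0.
    by move=> sg1 sg2; rewrite linearD /= pd_xm_neq // sg1 // sg2 // linear0 addr0.
  apply: (@xm_split0 a).
  - by apply: supp_out; do !(apply: suppD || apply: supp_eps || apply: supp_del).
  - by apply: supp_out; do !(apply: suppD || apply: supp_eps || apply: supp_del).
  rewrite -{}Ef fE !linearD /= epsF_xm2 ?s3 // !epsF_xm ?s1 ?s2 //.
  by char2 charF.
have [e0 e2] : E p0 + D p1 + D p2 + p3 = 0 /\ E p2 + D p3 = 0.
  by apply: (@xm_split0 b); rewrite // !linearD /= !(pd_eps, pd_del) ?s0 ?s1 ?s2 ?s3 // !(linear0, addr0).
have [e1 _] : E p1 + D p3 = 0 /\ E p3 = 0.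
  by apply: (@xm_split0 b); rewrite // ?linearD /= !(pd_eps, pd_del) ?s1 ?s3 // !(linear0, addr0).
have p3E : p3 = E p0 + D p1 + D p2.
  by apply: (eq_of_add2 charF); rewrite -[RHS]e0; char2 charF.
have Dp3 : D p3 = D (E p0).
  by rewrite p3E !linearD /= !delF2 !addr0.
(* Besides cancelling p0, the boundary of x_a x_b p0 adds [D p0] to the coefficients of x_a and
   x_b. *)
exists (p1 + D p0), (p2 + D p0), (xm a (xm b p0)); split.
- split; [by apply: suppD => //; apply: supp_del | | ].
    by apply: homogD => //; apply: homog_del hp0.
  by rewrite linearD /= -[RHS]e1 Dp3 del_eps.
- split; [by apply: suppD => //; apply: supp_del | | ].
    by apply: homogD => //; apply: homog_del hp0.
  by rewrite linearD /= -[RHS]e2 Dp3 del_eps.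
- split.
    by do 2![apply: supp_xm; first by rewrite !inE eqxx ?orbT]; do 2!apply: supp_cons.
  by apply: (@homog_xm _ (k + 1)); [lia | apply: homog_xm hp0].
rewrite {1}fE /zmap p3E !linearD /= !delF2 epsF_xm2 ?s0 // !linear0 !addr0 ![xm b (xm a _)]xmC.
by char2 charF.
Qed.

(** Removing two points lowers k by one, so 2k minus the number of points is constant; with at most
    one point left, the inequality excludes every k-subset. *)
Lemma bounds_far (s : seq T) k f : uniq s -> supp s f -> homog k f -> E f = 0 ->
  (k + k + 1 < (size s)%:Z) || ((size s)%:Z + 1 < k + k) -> bounds s k f.
Proof.
have [n] := ubnP (size s).
elim: n s k f => // n IH [|a [|b s]] k f le_n us sf hf Ef far.
1,2: suff -> : f = 0 by [apply: bounds0];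
     apply/ffunP=> X; rewrite ffunE; apply/eqP; apply: contraTT isT => nX;
     have := supp_card sf nX; have := hf _ nX; move: far => /=; lia.
have [f1 [f2 [h [[s1 h1 E1] [s2 h2 E2] [sh hh] ->]]]] := cycle_zmap us sf hf Ef.
have us' : uniq (b :: a :: s).
  by move: us; rewrite /= !inE eq_sym !negb_or -!andbA => /and4P[-> -> -> ->].
have us1 : uniq s by move: us => /= /and3P[].
have fars : (k - 1 + (k - 1) + 1 < (size s)%:Z) || ((size s)%:Z + 1 < k - 1 + (k - 1)).
  by move: far => /=; lia.
apply: boundsD; first apply: boundsD.
- by apply: (@bounds_zmap _ _ _ _ (k - 1)); rewrite ?subrK //; apply: IH => //; move: le_n => /=; lia.
- have [q [sq hq ->]] : bounds (b :: a :: s) k (zmap b a f2).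
    by apply: (@bounds_zmap _ _ _ _ (k - 1)); rewrite ?subrK //; apply: IH => //; move: le_n => /=; lia.
  exists q; split=> //; apply: supp_sub sq => x.
  by rewrite !inE orbCA.
by exists h.
Qed.

End Cycles.

(** * Polytabloids, generators and socle of the middle homology *)

Section Products.

Variables (F : fieldType) (T : finType).
Local Notation Lam := {ffun {set T} -> F^o}.
Local Notation D := (@del F T (enum T)).
Local Notation E := (@eps F T (enum T)).
Implicit Types (f g h : Lam) (s r : seq T) (a b : T) (c : F) (k : int).
Implicit Types (m : nat) (ps : seq (T * T)) (W : Lam -> Prop).

Fixpoint flat ps : seq T :=
  if ps is p :: ps' then [:: p.1, p.2 & flat ps'] else [::].

(* A polytabloid when the pairs are disjoint. *)
Fixpoint Prod ps : Lam :=
  if ps is p :: ps' then xm p.1 (Prod ps') + xm p.2 (Prod ps') else lam1 F T.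

Lemma size_flat ps : size (flat ps) = (size ps).*2.
Proof. by elim: ps => //= p ps ->; rewrite doubleS. Qed.

Lemma supp_Prod ps : supp (flat ps) (Prod ps).
Proof.
elim: ps => [|p ps IH] /=; first exact: supp_one.
by apply: suppD; apply: supp_xm; rewrite ?inE ?eqxx ?orbT //; do 2!apply: supp_cons.
Qed.

Lemma homog_Prod ps k : k = (size ps)%:Z -> homog k (Prod ps).
Proof.
elim: ps k => [|p ps IH] k -> /=; first exact: homog_one.
by apply: homogD; (apply: (@homog_xm _ _ _ (size ps)%:Z); [lia | exact: IH]).
Qed.

Hypothesis charF : 2%N \in [pchar F].

Lemma del_Prod ps : uniq (flat ps) -> D (Prod ps) = 0.
Proof.
elim: ps => [|p ps IH] /=; first by rewrite del_one.
rewrite inE negb_or -andbA => /and4P[n12 n1 n2 /IH d0].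
by rewrite linearD /= !delF_xm // d0 !linear0 !add0r; char2 charF.
Qed.

Lemma eps_Prod ps : uniq (flat ps) -> E (Prod ps) = 0.
Proof.
elim: ps => [|p ps IH] /=; first by rewrite eps_one.
rewrite inE negb_or -andbA => /and4P[n12 n1 n2 u].
rewrite linearD /= !epsF_xm // ?supp_Prod ?inE //.
by rewrite IH // del_Prod // !linear0 !addr0.
Qed.

(** The shape of the vectors obtained from [v_vec] by permuting the points: one variable times m - 1
    pair factors. *)
Definition vform s m f :=
  if m is m'.+1 then exists b ps, [/\ uniq (b :: flat ps),
    {subset b :: flat ps <= s}, size ps = m' & f = xm b (Prod ps)]
  else f = lam1 F T.

Lemma vform_zmap a b r s m f : uniq [:: a, b & r] -> {subset [:: a, b & r] <= s} ->
  vform r m f -> vform s m.+1 (zmap a b f).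
Proof.
move=> u sub; case: m => [->|m [d [ps [ups sps szs ->]]]].
  exists a, [::]; split=> //=; last by rewrite /zmap del_one !linear0 addr0.
  by move=> x; rewrite inE => /eqP->; apply: sub; rewrite mem_head.
move: u => /=; rewrite !inE !negb_or -!andbA => /and4P[nab na nb ur].
move: (ups) => /= /andP[nd up].
exists a, ((b, d) :: ps); split=> //=; last 1 first.
(* As [D] sends x_d P to P, the image is x_a x_d P + x_a x_b P, that is x_a (x_b + x_d) P. *)
- rewrite /zmap delF_xm // del_Prod // linear0 add0r [RHS]linearD /=.
  by rewrite addrC.
- have out x : x \notin r -> (x != d) && (x \notin flat ps).
    move=> nx; rewrite -negb_or; apply: contra nx => xd; apply: sps.
    by rewrite inE.
  rewrite !inE !negb_or nab; have /andP[-> ->] := out _ na.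
  by have /andP[-> ->] := out _ nb; rewrite nd.
- move=> x; rewrite !inE => xs; apply: sub; rewrite !inE.
  case/or4P: xs => [->|->|/eqP->|xs]; rewrite ?orbT //.
    by rewrite sps ?mem_head ?orbT.
  by rewrite sps ?inE ?xs ?orbT.
by rewrite szs.
Qed.

(** Subspaces are predicates so that an induction can pull them back along [zmap] or along
    multiplication by x_a + x_b. *)
Definition lin_closed W :=
  W 0 /\ forall c f g, W f -> W g -> W (c *: f + g).

Lemma lin_closedD W f g : lin_closed W -> W f -> W g -> W (f + g).
Proof. by case=> _ cW Wf Wg; rewrite -[f]scale1r; apply: cW. Qed.

Lemma lin_closedZ W c f : lin_closed W -> W f -> W (c *: f).
Proof. by case=> W0 cW Wf; rewrite -[_ *: _]addr0; apply: cW. Qed.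

Lemma lin_closed_comp (th : {linear Lam -> Lam}) W :
  lin_closed W -> lin_closed (fun f => W (th f)).
Proof.
case=> W0 cW; split; first by rewrite linear0.
by move=> c f g Wf Wg; rewrite linearP; apply: cW.
Qed.

Definition contains_bounds s k W := forall h, supp s h -> homog (k + 2) h -> W (E h).

(** The induction passes to the preimages of [W] under [zmap a b] and [zmap b a], which contain the
    boundaries on the remaining points because these are chain maps. Two points go at a time, so
    both parities run together. *)
Lemma span_vform m s W f : uniq s -> size s = m.*2 \/ size s = m.*2.+1 ->
    supp s f -> homog m f -> E f = 0 ->
    lin_closed W -> (forall g, vform s m g -> W g) -> contains_bounds s m W -> W f.
Proof.
elim: m s W f => [|m IH] s W f us szs sf hf Ef clW Wv Wb.
  by rewrite (homog0E hf); apply: lin_closedZ => //; apply: Wv.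
case: s us szs sf Wv Wb => [|a [|b s]] us szs sf Wv Wb; try by move: szs => /=; lia.
have [f1 [f2 [h [[s1 h1 E1] [s2 h2 E2] [sh hh] ->]]]] := cycle_zmap charF us sf hf Ef.
have us' : uniq (b :: a :: s).
  by move: us; rewrite /= !inE eq_sym !negb_or -!andbA => /and4P[-> -> -> ->].
have us1 : uniq s by move: us => /= /and3P[].
have eqm : m.+1%:Z - 1 = m by lia.
have szs1 : size s = m.*2 \/ size s = m.*2.+1 by move: szs => /=; lia.
rewrite eqm in h1 h2.
have sub' : {subset [:: b, a & s] <= [:: a, b & s]} by move=> x; rewrite !inE orbCA.
apply: lin_closedD; rewrite //; last exact: Wb.
apply: lin_closedD => //.
- apply: (IH s (fun g => W (zmap a b g))) => //; first exact: lin_closed_comp.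
    by move=> g vg; apply: Wv; apply: vform_zmap vg.
  move=> g sg hg; have [||q [sq hq ->]] := @bounds_zmap _ _ charF a b s m.+1 m (E g) _ us.
  - lia.
  - by exists g.
  exact: Wb.
- apply: (IH s (fun g => W (zmap b a g))) => //; first exact: lin_closed_comp.
    by move=> g vg; apply: Wv; apply: vform_zmap vg.
  move=> g sg hg; have [||q [sq hq ->]] := @bounds_zmap _ _ charF b a s m.+1 m (E g) _ us'.
  - lia.
  - by exists g.
  by apply: Wb => //; apply: supp_sub sq.
Qed.

Lemma uniq_extend s r : uniq s -> uniq r -> {subset r <= s} ->
  exists r', perm_eq s (r ++ r').
Proof.
move=> us ur sub; exists [seq x <- s | x \notin r].
apply: uniq_perm; rewrite // ?cat_uniq ?ur ?filter_uniq //=.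
  by rewrite andbT; apply/hasPn => x; rewrite mem_filter => /andP[].
move=> x; rewrite mem_cat mem_filter; case: (boolP (x \in r)) => //= /sub ->.
by [].
Qed.

(* With an odd number of points, a v-form x_b P is homologous to
   (x_a + x_c) P, where a and c are the two remaining points. *)
Lemma span_Prod m s W f : uniq s -> size s = m.*2.+1 ->
    supp s f -> homog m f -> E f = 0 -> lin_closed W ->
    (forall ps, uniq (flat ps) -> {subset flat ps <= s} -> size ps = m -> W (Prod ps)) ->
    contains_bounds s m W -> W f.
Proof.
move=> us szs sf hf Ef clW Wp Wb; apply: (span_vform us _ sf hf Ef clW _ Wb); first by right.
case: m szs Wp Wb {hf} => [|m] szs Wp Wb g; first by move=> ->; apply: (Wp [::]).
case=> b [ps [ups sub szps ->]].
have [r pr] := uniq_extend us ups sub.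
have := perm_size pr; rewrite size_cat /= size_flat szs.
case: r pr => [|a [|d [|e r]]] pr /=; try lia.
move=> _; have pr' : perm_eq s ([:: a; d] ++ b :: flat ps).
  by apply: perm_trans pr _; rewrite perm_catC.
have := perm_uniq pr'; rewrite us => /esym /= /and4P[].
rewrite !inE !negb_or => /and3P[nad nab na] /andP[ndb nd] nb up.
have sub' : {subset a :: d :: b :: flat ps <= s}.
  by move=> x; rewrite (perm_mem pr').
(* Since [E] and [D] kill P, [E] sends x_a x_d x_b P to (x_a + x_d + x_b) P. *)
have -> : xm b (Prod ps) = Prod ((a, d) :: ps) + E (xm a (xm d (xm b (Prod ps)))).
  have sP x : x \notin flat ps -> pd x (Prod ps) = 0 by apply: supp_Prod.
  have DP := del_Prod up; have EP := eps_Prod up.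
  rewrite epsF_xm2 // ?pd_xm_neq ?sP ?linear0 // epsF_xm ?sP //.
  by rewrite delF_xm // EP DP !(linear0, addr0, add0r) /=; char2 charF.
apply: lin_closedD => //.
  apply: Wp; rewrite /= ?szps //.
    by rewrite inE negb_or nad na nd up.
  by move=> x; rewrite inE => /predU1P[->|]; [|rewrite inE => /predU1P[->|xp]];
     apply: sub'; rewrite !inE ?eqxx ?xp ?orbT.
apply: Wb.
  do 3!(apply: supp_xm; first by apply: sub'; rewrite !inE eqxx ?orbT).
  apply: (supp_sub _ (@supp_Prod ps)) => x xp; apply: sub'.
  by rewrite !inE xp !orbT.
apply: (@homog_xm _ _ _ (m%:Z + 2)); first by clear; lia.
apply: (@homog_xm _ _ _ (m%:Z + 1)); first by clear; lia.
by apply: (@homog_xm _ _ _ m); [clear; lia | apply: homog_Prod; rewrite szps].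
Qed.

(** Taking preimages makes the monomial of a set go to that of its image, as in [perm_mod]. *)
Definition permute (t : {perm T}) f : Lam := [ffun X : {set T} => f (t @^-1: X)].

Lemma permute_is_linear t : linear (permute t).
Proof. by move=> c f g; apply/ffunP => X; rewrite !ffunE. Qed.
HB.instance Definition _ t := GRing.isLinear.Build F Lam Lam _ (permute t) (permute_is_linear t).

Lemma permute_xm t a f : permute t (xm a f) = xm (t a) (permute t f).
Proof.
apply/ffunP=> X; rewrite !ffunE inE; case: ifP => // _; congr (f _).
by apply/setP=> x; rewrite !inE (inj_eq perm_inj).
Qed.

Lemma permute_pd t a f : permute t (pd a f) = pd (t a) (permute t f).
Proof.
apply/ffunP=> X; rewrite !ffunE inE; case: ifP => // _; congr (f _).
by apply/setP=> x; rewrite !inE (inj_eq perm_inj).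
Qed.

Lemma permute_one t : permute t (lam1 F T) = lam1 F T.
Proof.
apply/ffunP=> X; rewrite !ffunE; congr ((_ : bool)%:R).
apply/eqP/eqP => [|->]; last by rewrite preimset0.
move/setP=> E0; apply/setP=> x; have := E0 (t^-1%g x).
by rewrite !inE permKV.
Qed.

Lemma permute_del t s f : permute t (del s f) = del (map t s) (permute t f).
Proof. by elim: s => [|a s IH] /=; rewrite ?linear0 // linearD /= IH permute_pd. Qed.

Lemma perm_enum_map (t : {perm T}) : perm_eq (map t (enum T)) (enum T).
Proof.
apply: uniq_perm; rewrite ?(map_inj_uniq perm_inj) ?enum_uniq // => x.
by rewrite mem_enum; apply/mapP; exists (t^-1%g x); rewrite ?mem_enum ?permKV.
Qed.

Lemma permute_delF t f : permute t (D f) = D (permute t f).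
Proof. by rewrite permute_del (perm_del (perm_enum_map t)). Qed.

Definition map2 (t : T -> T) ps := [seq (t p.1, t p.2) | p <- ps].

Lemma flat_map2 t ps : flat (map2 t ps) = map t (flat ps).
Proof. by elim: ps => //= p ps ->. Qed.

Lemma permute_Prod t ps : permute t (Prod ps) = Prod (map2 t ps).
Proof.
by elim: ps => [|p ps IH] /=; rewrite ?permute_one // linearD /= !permute_xm IH.
Qed.

Lemma homog_permute t k f : homog k f -> homog k (permute t f).
Proof.
move=> hf X; rewrite ffunE => /hf <-; congr (_ %:Z).
rewrite -[RHS](card_imset _ (@perm_inj _ t)); apply: eq_card => x.
apply/idP/imsetP => [xX|[y]]; last by rewrite inE => yX ->.
by exists (t^-1%g x); rewrite ?inE permKV.
Qed.

Lemma permute_tperm a b f : pd a f = 0 -> pd b f = 0 -> permute (tperm a b) f = f.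
Proof.
move=> a0 b0; apply/ffunP=> X; rewrite ffunE.
set Y := _ @^-1: X.
have aY : (a \in Y) = (b \in X) by rewrite inE tpermL.
have bY : (b \in Y) = (a \in X) by rewrite inE tpermR.
have [aX|aX] := boolP (a \in X).
  by rewrite (pd0_val a0 aX) (pd0_val b0) // bY.
have [bX|bX] := boolP (b \in X).
  by rewrite (pd0_val b0 bX) (pd0_val a0) // aY.
congr (f _); apply/setP=> x; rewrite inE.
by case: tpermP => // ->; rewrite ?(negPf aX) ?(negPf bX).
Qed.

Lemma permute_zmap t a b f : permute t (zmap a b f) = zmap (t a) (t b) (permute t f).
Proof. by rewrite linearD /= !permute_xm permute_delF. Qed.

(* On s = 2m or 2m + 1 points the group generated by m disjoint transpositions
   acts on the homology in degree m as on its regular module, whose socle is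
   spanned by the class of the product. *)
Lemma socle m s W f : uniq s -> size s = m.*2 \/ size s = m.*2.+1 ->
    supp s f -> homog m f -> E f = 0 ->
    lin_closed W ->
    (forall a b g, a \in s -> b \in s -> W g -> W (permute (tperm a b) g)) ->
    contains_bounds s m W -> W f ->
  bounds s m f \/ exists ps, [/\ uniq (flat ps), {subset flat ps <= s},
    size ps = m & W (Prod ps)].
Proof.
elim: m s W f => [|m IH] s W f us szs sf hf Ef clW Wt Wb Wf.
  have [f0|nf] := eqVneq f 0; first by left; rewrite f0; apply: bounds0.
  right; exists [::]; split=> //=.
  have := homog0E hf; have [-> fE|nz fE] := eqVneq (f set0) 0.
    by rewrite fE scale0r eqxx in nf.
  have -> : lam1 F T = (f set0)^-1 *: f by rewrite {2}fE scalerA mulVf // scale1r.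
  exact: lin_closedZ.
case: s us szs sf Wt Wb => [|a [|b s]] us szs sf Wt Wb; try by move: szs => /=; lia.
have [f1 [f2 [h [[s1 h1 E1] [s2 h2 E2] [sh hh] fE]]]] := cycle_zmap charF us sf hf Ef.
have eqm : m.+1%:Z - 1 = m by lia.
have szs1 : size s = m.*2 \/ size s = m.*2.+1 by move: szs => /=; lia.
rewrite eqm in h1 h2; move: (us) => /=; rewrite !inE negb_or -andbA => /and4P[nab nas nbs us1].
have us' : uniq (b :: a :: s).
  by rewrite /= !inE eq_sym negb_or nab nas nbs us1.
have sub' : {subset [:: b, a & s] <= [:: a, b & s]} by move=> x; rewrite !inE orbCA.
(* Multiplication by x_a + x_b is a chain map in characteristic 2 and commutes with the
   transpositions of the remaining points, so [W'] satisfies the hypotheses there. *)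
pose W' g := W (xm a g + xm b g).
have bz g : bounds s m g -> bounds (a :: b :: s) m.+1 (zmap b a g).
  move=> bg; have [|q [sq hq ->]] := @bounds_zmap _ _ charF b a s m.+1 m g _ us' bg.
    by lia.
  by exists q; split=> //; apply: supp_sub sq.
have Wbd g : bounds (a :: b :: s) m.+1 g -> W g by case=> q [sq hq ->]; apply: Wb.
have zz g : zmap a b g + zmap b a g = xm a g + xm b g.
  by rewrite /zmap [xm b (xm a _)]xmC; char2 charF.
have use g : supp s g -> homog m g -> E g = 0 -> W' g -> bounds s m g \/
    exists ps, [/\ uniq (flat ps), {subset flat ps <= a :: b :: s}, size ps = m.+1 & W (Prod ps)].
  move=> sg hg Eg W'g; have [||||bg|[ps [ups sub szps Wps]]] := IH s W' g us1 szs1 sg hg Eg.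
  - split; first by rewrite /W' !linear0 addr0; case: clW.
    move=> c g1 g2 Wg1 Wg2; rewrite /W' !linearP addrACA -scalerDr.
    by case: clW => _; apply.
  - move=> d e q ds es W'q; rewrite /W'.
    have na : tperm d e a = a by rewrite tpermD //; apply: contraNneq nas => <-.
    have nb : tperm d e b = b by rewrite tpermD //; apply: contraNneq nbs => <-.
    rewrite -{1}na -{1}nb -!permute_xm -linearD; apply: Wt => //.
      by rewrite !inE ds !orbT.
    by rewrite !inE es !orbT.
  - move=> q sq hq; rewrite /W'.
    have -> : xm a (E q) + xm b (E q) = E (xm a q + xm b q).
      by rewrite linearD /= !epsF_xm ?sq //; char2 charF.
    apply: Wb.
      by apply: suppD; apply: supp_xm; rewrite ?inE ?eqxx ?orbT //; do 2!apply: supp_cons.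
    by apply: homogD; apply: homog_xm hq; lia.
  - exact: W'g.
  - by left.
  right; exists ((a, b) :: ps); split=> //=; rewrite ?szps //.
    by rewrite inE negb_or nab ups andbT /=; apply/andP; split;
      [apply: contra nas | apply: contra nbs]; apply: sub.
  by move=> x; rewrite !inE => /or3P[->|->|/sub ->]; rewrite ?orbT.
(* Up to boundaries, the sum of f and its image under the transposition of [a] and [b] is (x_a +
   x_b)(f1 + f2). *)
have [] := use (f1 + f2).
- exact: suppD.
- exact: homogD.
- by rewrite linearD /= E1 E2 addr0.
- have fEE : f + E h = zmap a b f1 + zmap b a f2 by rewrite fE; char2 charF.
  rewrite /W' -zz [zmap a b _]linearD [zmap b a _]linearD /=.
  have -> : zmap a b f1 + zmap a b f2 + (zmap b a f1 + zmap b a f2) =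
      (f + E h) + permute (tperm a b) (f + E h).
    rewrite fEE [permute _ _]linearD /= !permute_zmap tpermL tpermR !permute_tperm ?s1 ?s2 //.
    by char2 charF.
  have WfE : W (f + E h) by apply: lin_closedD => //; apply: Wb.
  by apply: lin_closedD => //; apply: Wt; rewrite ?inE ?eqxx ?orbT.
(* If f1 + f2 bounds, then f is (x_a + x_b) f1 up to boundaries, and the induction hypothesis
   applies to f1. *)
- move=> b12.
  have Wb12 := bz _ b12.
  have f1E : zmap a b f1 + zmap b a f1 = f + (E h + zmap b a (f1 + f2)).
    by rewrite fE [zmap b a (_ + _)]linearD /=; char2 charF.
  have [||||b1|R] := use f1; rewrite //.
  + rewrite /W' -zz f1E; apply: lin_closedD => //.
    by apply: lin_closedD => //; [apply: Wb | apply: Wbd].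
  + left; have -> : f = zmap a b f1 + zmap b a f1 + (E h + zmap b a (f1 + f2)).
      by rewrite f1E; char2 charF.
    apply: boundsD; last by apply: boundsD => //; exists h.
    by apply: boundsD; [apply: (@bounds_zmap _ _ charF _ _ _ _ m) => //; lia | apply: bz].
  + by right.
by right.
Qed.

End Products.

(** * Orthogonality to polytabloids *)

Section Orthogonality.

Variables (F : fieldType) (T : finType).

Local Notation Lam := {ffun {set T} -> F^o}.
Local Notation D := (@del F T (enum T)).
Local Notation E := (@eps F T (enum T)).
Implicit Types (f g h : Lam) (s r : seq T) (a b : T) (c : F) (k : int).
Implicit Types (m p : nat) (ps : seq (T * T)) (W : Lam -> Prop).

Fixpoint pd_pairs ps f : Lam :=
  if ps is p :: ps' then pd_pairs ps' (pd p.1 f + pd p.2 f) else f.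

Lemma pd_pairs_is_linear ps : linear (pd_pairs ps).
Proof.
elim: ps => //= p ps IH c f g.
by rewrite -IH scalerDr !linearP addrACA.
Qed.
HB.instance Definition _ ps :=
  GRing.isLinear.Build F Lam Lam _ (pd_pairs ps) (pd_pairs_is_linear ps).

(* As pd a is adjoint to xm a, this is the coordinate form of f and [Prod ps]. *)
Definition pairing ps f : F := pd_pairs ps f set0.

Lemma pairingP ps c f g : pairing ps (c *: f + g) = c * pairing ps f + pairing ps g.
Proof. by rewrite /pairing linearP !ffunE. Qed.

Lemma pairing0 ps : pairing ps 0 = 0.
Proof. by rewrite /pairing linear0 ffunE. Qed.

Lemma pairingD ps f g : pairing ps (f + g) = pairing ps f + pairing ps g.
Proof. by rewrite /pairing linearD ffunE. Qed.

Lemma pairing_xm ps a f : a \notin flat ps -> pairing ps (xm a f) = 0.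
Proof.
rewrite /pairing => na; have -> : pd_pairs ps (xm a f) = xm a (pd_pairs ps f).
  elim: ps f na => //= p ps IH f; rewrite !inE !negb_or => /and3P[n1 n2 na].
  by rewrite !pd_xm_neq 1?eq_sym // -linearD IH.
by rewrite ffunE inE.
Qed.

Lemma pairing_coord ps f : pairing ps f = \sum_X f X * Prod F ps X.
Proof.
have adj a (h g : Lam) : \sum_X h X * xm a g X = \sum_X pd a h X * g X.
  rewrite (bigID (fun X : {set T} => a \in X)) /= addrC big1 ?add0r; last first.
    by move=> X na; rewrite ffunE (negPf na); apply: mulr0.
  rewrite [RHS](bigID (fun X : {set T} => a \in X)) /= [X in _ = X + _]big1 ?add0r; last first.
    by move=> X aX; rewrite ffunE aX; apply: mul0r.
  rewrite (reindex_onto (fun X : {set T} => a |: X) (fun X => X :\ a)) /=; last first.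
    by move=> X aX; rewrite setD1K.
  apply: eq_big => X; rewrite setU11 /=.
    apply/eqP/idP => [<-|]; last exact: setU1K.
    by rewrite setD11.
  by move/eqP=> XE; rewrite !ffunE setU11 XE -{3}XE setD11.
elim: ps f => [|p ps IH] f; rewrite /pairing /=.
  rewrite (bigD1 set0) //= ffunE eqxx mulr1 big1 ?addr0 // => X nX.
  by rewrite ffunE (negPf nX); apply: mulr0.
rewrite -/(pairing ps _) IH.
transitivity (\sum_X f X * xm p.1 (Prod F ps) X + \sum_X f X * xm p.2 (Prod F ps) X).
  by rewrite !adj -big_split; apply: eq_bigr => X _; rewrite ffunE mulrDl.
by rewrite -big_split; apply: eq_bigr => X _; rewrite [in RHS]ffunE mulrDr.
Qed.

Lemma pairing_permute (t : {perm T}) ps f : pairing ps (permute t f) = pairing (map2 (fun x => (t^-1)%g x) ps) f.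
Proof.
rewrite /pairing; have -> : pd_pairs ps (permute t f) = permute t (pd_pairs (map2 (fun x => (t^-1)%g x) ps) f).
  by elim: ps f => //= p ps IH f; rewrite -IH [permute t (_ + _)]linearD /= !permute_pd !permKV.
by rewrite ffunE preimset0.
Qed.

Lemma pd_pd_pairs a ps f : pd a (pd_pairs ps f) = pd_pairs ps (pd a f).
Proof. by elim: ps f => //= p ps IH f; rewrite IH linearD /= !(pdC a). Qed.

Hypothesis charF : 2%N \in [pchar F].

(* Along a path x_0, ..., x_(2m) the pairs (x_0, x_1), (x_2, x_3), ... and
   (x_1, x_2), (x_3, x_4), ... have the single common transversal
   {x_1, x_3, ...}. *)
Lemma path_pairs a ps : uniq (a :: flat ps) ->
  exists ps', [/\ size ps' = size ps, uniq (flat ps'),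
    {subset flat ps' <= a :: flat ps} & pairing ps' (Prod F ps) = 1].
Proof.
elim: ps a => [|[x1 x2] ps IH] x0.
  by exists [::]; split=> //; rewrite /pairing ffunE eqxx.
move=> us; move: (us) => /= /and4P[]; rewrite !inE !negb_or.
move=> /and3P[n01 n02 n0] /andP[n12 n1] n2 us1.
have [|ps' [szps' ups' sub pe]] := IH x2; first by rewrite /= n2.
exists ((x0, x1) :: ps'); split=> /=; first by rewrite szps'.
- have out x : x != x2 -> x \notin flat ps -> x \notin flat ps'.
    by move=> nx ns; apply/negP => /sub; rewrite inE (negPf nx) (negPf ns).
  by rewrite inE negb_or n01 ups' !out.
- by move=> x; rewrite !inE => /or3P[->|->|/sub]; rewrite ?orbT // inE => /orP[]->; rewrite !orbT.
rewrite -pe /pairing /=; congr (pd_pairs ps' _ set0).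
have sP x : x \notin flat ps -> pd x (Prod F ps) = 0 by apply: supp_Prod.
rewrite !linearD /= pd_xmE // !pd_xm_neq // !sP // !linear0.
by rewrite !(addr0, add0r).
Qed.

(** In characteristic 2 a factor [pd a + pd b] squares to zero, and it kills [pd a] composed with
    [pd b]; hence the points of the pairs contribute nothing to e_2. *)
Lemma pd_pairs_eps ps r f :
  pd_pairs ps (eps (flat ps ++ r) f) = pd_pairs ps (eps r f).
Proof.
elim: ps f => //= p ps IH f.
have -> : pd p.1 (eps (flat ps ++ r) f + pd p.2 (del (flat ps ++ r) f) +
                  pd p.1 (del (flat ps ++ r) f + pd p.2 f)) +
          pd p.2 (eps (flat ps ++ r) f + pd p.2 (del (flat ps ++ r) f) +
                  pd p.1 (del (flat ps ++ r) f + pd p.2 f)) =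
          eps (flat ps ++ r) (pd p.1 f + pd p.2 f).
  rewrite !linearD /= !pd_pd !(pdC p.2 p.1) !pd_pd !linear0 !pd_eps.
  by char2 charF.
by rewrite IH linearD /= -!pd_eps.
Qed.

Lemma pd_pairs_del ps r f :
  pd_pairs ps (del (flat ps ++ r) f) = pd_pairs ps (del r f).
Proof.
elim: ps f => //= p ps IH f.
have -> : pd p.1 (del (flat ps ++ r) f + pd p.2 f + pd p.1 f) +
          pd p.2 (del (flat ps ++ r) f + pd p.2 f + pd p.1 f) =
          del (flat ps ++ r) (pd p.1 f + pd p.2 f).
  rewrite !linearD /= !pd_pd !(pdC p.2 p.1) !pd_del.
  by char2 charF.
by rewrite IH linearD /= -!pd_del.
Qed.

Definition perp s m f := forall ps, uniq (flat ps) -> {subset flat ps <= s} ->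
  size ps = m -> pairing ps f = 0.

Lemma perp_closed s m : lin_closed (perp s m).
Proof.
split=> [|c f g pf pg] ps u sub sz; first exact: pairing0.
by rewrite pairingP pf // pg // mulr0 addr0.
Qed.

(** The m pairs leave a single point, and e_2 of one derivation is zero. *)
Lemma perp_bounds s m k f : uniq s -> size s = m.*2.+1 -> bounds s k f -> perp s m f.
Proof.
move=> us szs [h [sh _ ->]] ps ups sub szps.
have [r pr] := uniq_extend us ups sub.
have := perm_size pr; rewrite size_cat size_flat szs szps.
case: r pr => [|a [|d r]] pr /=; try lia; move=> _.
rewrite /pairing (eps_supp us sh) (perm_eps pr) pd_pairs_eps /=.
by rewrite linear0 addr0 linear0 ffunE.
Qed.

Lemma perp_permute s m a b f : a \in s -> b \in s -> perp s m f ->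
  perp s m (permute (tperm a b) f).
Proof.
move=> sa sb pf ps ups sub szps; rewrite pairing_permute; apply: pf.
- by rewrite flat_map2 (map_inj_uniq perm_inj).
- move=> x; rewrite flat_map2 => /mapP[y yp ->]; rewrite tpermV.
  by case: tpermP => // _ _; apply: sub.
by rewrite size_map.
Qed.

(** Otherwise [socle] would put a polytabloid into the space orthogonal to all polytabloids, against
    [path_pairs] started at the leftover point. *)
Lemma bounds_perp s m f : uniq s -> size s = m.*2.+1 ->
  supp s f -> homog m f -> E f = 0 -> perp s m f -> bounds s m f.
Proof.
move=> us szs sf hf Ef pf.
have [||||//|[ps' [ups' sub' szps' pP]]] :=
  @socle _ _ charF m s (perp s m) f us (or_intror szs) sf hf Ef.
- exact: perp_closed.
- by move=> a b g sa sb; apply: perp_permute.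
- by move=> h sh hh; apply: (@perp_bounds _ _ m); rewrite //; exists h.
- exact: pf.
have [r pr] := uniq_extend us ups' sub'.
have := perm_size pr; rewrite size_cat size_flat szs szps'.
case: r pr => [|d [|e r]] pr /=; try lia; move=> _.
have pr' : perm_eq s (d :: flat ps') by apply: perm_trans pr _; rewrite perm_catC.
have [|ps [szps ups sub pe]] := @path_pairs d ps'; first by rewrite -(perm_uniq pr').
have := pP ps ups _ _; rewrite pe szps szps' => E1.
by have /eqP := E1 (fun x xp => etrans (perm_mem pr' x) (sub x xp)) erefl; rewrite oner_eq0.
Qed.

End Orthogonality.

(** * Splitting off one point *)

Section OnePoint.

Variables (F : fieldType) (T : finType).
Hypothesis charF : 2%N \in [pchar F].

Local Notation Lam := {ffun {set T} -> F^o}.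
Local Notation D := (@del F T (enum T)).
Local Notation E := (@eps F T (enum T)).
Implicit Types (f g h : Lam) (s r : seq T) (a b : T) (c : F) (k : int).
Implicit Types (m p : nat) (ps : seq (T * T)) (W : Lam -> Prop).

(** The part of f free of x_a; the coefficient of x_a is [pd a f]. *)
Definition co0 a f := pd a (xm a f).

Lemma co0_is_linear a : linear (co0 a).
Proof. by move=> c f g; rewrite /co0 !linearP. Qed.
HB.instance Definition _ a := GRing.isLinear.Build F Lam Lam _ (co0 a) (co0_is_linear a).

Lemma co0E a f : f = co0 a f + xm a (pd a f).
Proof. by rewrite pd_xm. Qed.

Lemma pd_co0 a f : pd a (co0 a f) = 0. Proof. exact: pd_pd. Qed.

Lemma homog_co0 a k f : homog k f -> homog k (co0 a f).
Proof. by move=> hf; apply: (@homog_pd _ _ _ (k + 1)); [lia | apply: homog_xm hf]. Qed.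

Lemma co0_id a f : pd a f = 0 -> co0 a f = f.
Proof. by move=> f0; rewrite {2}(co0E a f) f0 linear0 addr0. Qed.

Lemma del_co0 a f : co0 a (D f) = D (co0 a f) + pd a f.
Proof.
rewrite /co0; have -> : xm a (D f) = D (xm a f) + f by rewrite delF_xm //; char2 charF.
by rewrite linearD /= pd_del.
Qed.

Lemma eps_co0 a f : co0 a (E f) = E (co0 a f) + D (pd a f).
Proof.
rewrite /co0.
have -> : xm a (E f) = E (xm a f) + D f + pd a f.
  by rewrite eps_xm ?enum_uniq ?mem_enum //; char2 charF.
by rewrite !linearD /= pd_eps pd_del pd_pd addr0.
Qed.

Lemma supp_xm_cons a s f : supp s f -> supp (a :: s) (xm a f).
Proof. by move=> sf; apply: supp_xm; [rewrite mem_head | apply: supp_cons]. Qed.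

Lemma supp_of_pd0 a s f : supp (a :: s) f -> pd a f = 0 -> supp s f.
Proof. by move=> sf f0; rewrite -(co0_id f0); apply: supp_pd_xm. Qed.

(* Long exact sequence for removing the point a: in degrees where the homology
   on s vanishes, cycles and boundaries can be pushed onto s. *)
Lemma bounds_restrict a s k f : uniq s -> supp s f -> a \notin s ->
    (k + k + 3 < (size s)%:Z) || ((size s)%:Z < k + k + 1) ->
    bounds (a :: s) k f -> bounds s k f.
Proof.
move=> us sf na far [h [sh hh fE]].
have f0 : pd a f = 0 by apply: sf.
have e1 : E (pd a h) = 0 by rewrite -pd_eps -fE.
have [||||q [sq hq hE]] := @bounds_far _ _ charF s (k + 1) (pd a h) us.
- exact: supp_pd.
- by apply: homog_pd hh; lia.
- by [].
- by move: far; lia.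
(* For h = h0 + x_a h1 the equation f = E h reads f = E h0 + D h1 and E h1 = 0; moreover h1 = E q,
   so D h1 = E (D q). *)
exists (co0 a h + D q); split.
- by apply: suppD; [apply: supp_pd_xm | apply: supp_del].
- by apply: homogD; [apply: homog_co0 | apply: homog_del hq; lia].
rewrite -(co0_id f0) fE eps_co0 linearD /= hE -del_eps.
by [].
Qed.

Lemma cycle_restrict a s k f : uniq s -> a \notin s -> supp (a :: s) f ->
    homog k f -> E f = 0 ->
    (k + k < (size s)%:Z + 1) || ((size s)%:Z + 3 < k + k) ->
  exists f', [/\ supp s f', homog k f', E f' = 0 & bounds (a :: s) k (f + f')].
Proof.
move=> us na sf hf Ef far.
have [||||q [sq hq fE]] := @bounds_far _ _ charF s (k - 1) (pd a f) us.
- exact: supp_pd.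
- by apply: homog_pd hf.
- by rewrite -pd_eps Ef linear0.
- by move: far; lia.
have hx : homog (k + 2) (xm a q) by apply: homog_xm hq; lia.
exists (f + E (xm a q)); split.
- apply: (@supp_of_pd0 a).
    by apply: suppD => //; apply: supp_eps; apply: supp_xm_cons.
  by rewrite linearD /= pd_eps pd_xmE // sq // linear0 addr0 -fE addv2.
- by apply: homogD => //; apply: homog_eps hx; lia.
- by rewrite linearD /= Ef epsF2 // addr0.
by exists (xm a q); split=> //; [apply: supp_xm_cons | char2 charF].
Qed.

(** The 2m points other than [a] have no homology in degree m + 1. With f = f0 + x_a f1 and h = h0 +
    x_a h1, this applies first to f0 + h1, which makes f1 a boundary, and then to f with its
    x_a-part removed. So [D] is injective from the homology in degree m + 1 to that in degree m. *)
Lemma del_inj m s f : uniq s -> size s = m.*2.+1 -> supp s f -> homog (m%:Z + 1) f ->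
  E f = 0 -> bounds s m (D f) -> bounds s (m%:Z + 1) f.
Proof.
case: s => // a s /= /andP[na us] [szs] sf hf Ef [h [sh hh dE]].
have e1 : pd a f = D (co0 a f + pd a h) + E (co0 a h).
  have := congr1 (co0 a) dE; rewrite del_co0 eps_co0 => /(add2_move charF) ->.
  by rewrite linearD /=; char2 charF.
have e2 : E (co0 a f) = D (pd a f).
  have := eps_co0 a f; rewrite Ef linear0 => e; apply: (eq_of_add2 charF).
  by rewrite -e.
have e3 : E (pd a h) = D (pd a f) by rewrite -pd_eps -dE pd_del.
have [||||q [sq hq qE]] := @bounds_far _ _ charF s (m%:Z + 1) (co0 a f + pd a h) us.
- by apply: suppD; [apply: supp_pd_xm | apply: supp_pd].
- by apply: homogD; [apply: homog_co0 | apply: homog_pd hh; lia].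
- by rewrite linearD /= e2 e3 addv2.
- by move: szs; lia.
have sq' : supp s (D q + co0 a h) by apply: suppD; [apply: supp_del | apply: supp_pd_xm].
have hq' : homog (m%:Z + 2) (D q + co0 a h).
  by apply: homogD; [apply: homog_del hq; lia | apply: homog_co0].
have f1E : pd a f = E (D q + co0 a h) by rewrite e1 qE linearD /= del_eps.
have [||||r [sr hr rE]] := @bounds_far _ _ charF s (m%:Z + 1) (f + E (xm a (D q + co0 a h))) us.
- apply: (@supp_of_pd0 a).
    by apply: suppD => //; apply: supp_eps; apply: supp_xm_cons.
  by rewrite linearD /= pd_eps pd_xmE // sq' // linear0 addr0 -f1E addv2.
- apply: homogD => //; apply: (@homog_eps _ _ _ (m%:Z + 3)); first lia.
  by apply: homog_xm hq'; lia.
- by rewrite linearD /= Ef epsF2 // addr0.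
- by move: szs; lia.
exists (r + xm a (D q + co0 a h)); split.
- by apply: suppD; [apply: supp_cons | apply: supp_xm_cons].
- by apply: homogD => //; apply: homog_xm hq'; lia.
by rewrite linearD /= -rE; char2 charF.
Qed.

(** First f is replaced by f' on the 2m points other than [a]. These have no homology in degree m -
    1, so D f' = E h, and x_a f' + h is the cycle sought. *)
Lemma del_surj m s f : uniq s -> size s = m.*2.+1 -> supp s f -> homog m f ->
  E f = 0 -> exists g, [/\ supp s g, homog (m%:Z + 1) g, E g = 0 & bounds s m (D g + f)].
Proof.
case: s => // a s /= /andP[na us] [szs] sf hf Ef.
have [|f' [sf' hf' Ef' bf]] := cycle_restrict us na sf hf Ef.
  by rewrite szs; lia.
have [||||h [sh hh dE]] := @bounds_far _ _ charF s (m%:Z - 1) (D f') us.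
- exact: supp_del.
- by apply: homog_del hf'.
- by rewrite -del_eps Ef' linear0.
- by rewrite szs; lia.
exists (xm a f' + h); split.
- by apply: suppD; [apply: supp_xm_cons | apply: supp_cons].
- by apply: homogD; [apply: homog_xm hf' | move: hh; rewrite (_ : m%:Z - 1 + 2 = m%:Z + 1) //; lia].
- by rewrite linearD /= epsF_xm ?sf' // Ef' linear0 add0r dE addv2.
have -> : D (xm a f' + h) + f = E (xm a h) + (f + f').
  by rewrite linearD /= delF_xm // dE epsF_xm ?sh //; char2 charF.
apply: boundsD => //; exists (xm a h); split=> //; first exact: supp_xm_cons.
by apply: homog_xm hh; lia.
Qed.

End OnePoint.

(** * An even number of points: reduction to one point fewer *)

Section Chains.

Variables (F : fieldType) (T : finType).
Hypothesis charF : 2%N \in [pchar F].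

Local Notation Lam := {ffun {set T} -> F^o}.
Local Notation D := (@del F T (enum T)).
Local Notation E := (@eps F T (enum T)).
Implicit Types (f g h : Lam) (a b : T) (c : F) (k : int).
Implicit Types (m : nat) (ps : seq (T * T)) (W : Lam -> Prop).

Variables (p : nat) (a0 : T) (s : seq T).
Hypotheses (ps_full : perm_eq (enum T) (a0 :: s)) (szs : size s = p.*2.+1).

Let us : uniq s.
Proof. by have := perm_uniq ps_full; rewrite enum_uniq => /esym /= /andP[]. Qed.
Let na0 : a0 \notin s.
Proof. by have := perm_uniq ps_full; rewrite enum_uniq => /esym /= /andP[]. Qed.

Let suppF f : supp (a0 :: s) f.
Proof. by move=> a; rewrite -(perm_mem ps_full) mem_enum. Qed.

(** An element killed by [D] has [D] of its x_a0-free part as coefficient of x_a0. Thus g + x_a0 D g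
    is the extension of g killed by [D], and its image under [E] is y. *)
Lemma boundary_of_co0 y : D y = 0 -> bounds s p (co0 a0 y) ->
  exists G, [/\ homog (p%:Z + 2) G, y = E G & D G = 0].
Proof.
move=> Dy [g [sg hg yE]]; exists (g + xm a0 (D g)); split.
- by apply: homogD => //; apply: (@homog_xm _ _ _ (p%:Z + 1)); [lia | apply: homog_del hg; lia].
- have y1 : pd a0 y = D (E g).
    by have := del_co0 charF a0 y; rewrite Dy linear0 -yE => /esym/(add2_move charF); rewrite addr0.
  rewrite {1}(co0E a0 y) yE y1 linearD /= epsF_xm ?pd_del ?sg ?linear0 //.
  by rewrite delF2 // addr0 -del_eps.
by rewrite linearD /= delF_xm // delF2 // linear0 add0r addv2.
Qed.

Lemma two_rest ps : uniq (flat ps) -> size ps = p ->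
  exists a b, perm_eq (enum T) (flat ps ++ [:: a; b]).
Proof.
move=> ups szps; have [|r pr] := uniq_extend (enum_uniq T) ups.
  by move=> x; rewrite mem_enum.
have := perm_size pr; rewrite size_cat (perm_size ps_full) /= szs size_flat szps.
case: r pr => [|a [|b [|d r]]] pr /=; try lia; move=> _.
by exists a, b.
Qed.

(** Against the pairs, both operators reduce to the mixed second derivative at the two leftover
    points. *)
Lemma pairing_eps_rest ps a b G : perm_eq (enum T) (flat ps ++ [:: a; b]) ->
  pairing ps (E G) = pairing ps (pd a (D G)).
Proof.
move=> pr; rewrite /pairing (perm_eps pr) pd_pairs_eps // (perm_del pr).
rewrite -pd_pd_pairs pd_pairs_del // pd_pd_pairs /= !linear0 !add0r.
by rewrite linearD /= pd_pd addr0.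
Qed.

Lemma perp_boundary G : D G = 0 -> perp (enum T) p (E G).
Proof.
move=> DG ps ups _ szps; have [a [b pr]] := two_rest ups szps.
by rewrite (pairing_eps_rest _ pr) DG linear0 pairing0.
Qed.

Lemma perp_del_bounds G h : D G = E h -> perp (enum T) p (E G).
Proof.
move=> DG ps ups _ szps; have [a [b pr]] := two_rest ups szps.
rewrite (pairing_eps_rest _ pr) DG pd_eps (pairing_eps_rest _ pr) -pd_del.
by rewrite pd_pd pairing0.
Qed.

(** Polytabloids on [s] avoid a0 and see only the x_a0-free part; on the 2p + 1 points of [s]
    orthogonality detects boundaries. *)
Lemma perp_co0 y : homog p y -> D y = 0 -> E y = 0 -> perp (enum T) p y ->
  bounds s p (co0 a0 y).
Proof.
move=> hy Dy Ey py.
have y1 : pd a0 y = D (co0 a0 y).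
  by have := del_co0 charF a0 y; rewrite Dy linear0 => /esym/(add2_move charF); rewrite addr0.
apply: (bounds_perp charF us szs).
- exact: supp_pd_xm.
- exact: homog_co0.
- have := eps_co0 charF a0 y; rewrite Ey linear0 y1 delF2 // addr0.
  by move=> <-.
move=> ps ups sub szps.
have := py ps ups _ szps; rewrite {1}(co0E a0 y) pairingD pairing_xm.
  by rewrite addr0; apply=> x; rewrite mem_enum.
by apply: contra na0; apply: sub.
Qed.

(* With 2(p + 1) points, sending E g to the class of D g defines a map from the
   Specht module in degree p to the homology in degree p + 1. *)
Lemma perp_eps_iff g : homog (p%:Z + 2) g -> D (E g) = 0 ->
  perp (enum T) p (E g) <-> bounds (enum T) (p%:Z + 1) (D g).
Proof.
move=> hg DEg; split=> [pg|[h [_ _ dE]]]; last exact: perp_del_bounds dE.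
have [||G [hG eG DG]] := @boundary_of_co0 (E g).
- exact: DEg.
- apply: perp_co0 => //; last exact: epsF2.
  by apply: homog_eps hg; lia.
(* On 2p + 2 points there is no homology in degree p + 2, so the cycle g + G bounds. *)
have [||||q [sq hq gE]] := @bounds_far _ _ charF (enum T) (p%:Z + 2) (g + G) (enum_uniq T).
- exact: supp_enum.
- exact: homogD.
- by rewrite linearD /= eG addv2.
- by rewrite (perm_size ps_full) /= szs; lia.
have -> : g = G + E q by rewrite -gE; char2 charF.
rewrite linearD /= DG add0r del_eps; exists (D q); split=> //; first exact: supp_enum.
by apply: homog_del hq; lia.
Qed.

(** By [span_Prod] the coefficient of x_a0 in f is that of some u in [W]; then f + u is free of x_a0
    and bounds by [del_inj]. This is what determines the kernel of the map that [D] induces from the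
    middle homology. *)
Lemma perp_del_span W f : homog (p%:Z + 1) f -> E f = 0 -> perp (enum T) p (D f) ->
  lin_closed W -> (forall ps, uniq (flat ps) -> size ps = p.+1 -> W (Prod F ps)) ->
  contains_bounds (enum T) (p%:Z + 1) W -> W f.
Proof.
move=> hf Ef pf clW WP Wb.
have [||G [hG fE DG]] := @boundary_of_co0 (D f).
- exact: delF2.
- apply: perp_co0 => //; first by apply: homog_del hf; lia.
    exact: delF2.
  by rewrite -del_eps Ef linear0.
(* The last clause keeps track of D u, so that D (f + u) is the image under [E] of an element killed
   by [D] and hence bounds on [s], as [del_inj] requires. *)
pose W1 g := exists u, [/\ W u, homog (p%:Z + 1) u, E u = 0, pd a0 u = g &
  exists2 G', D u = E G' & D G' = 0 /\ homog (p%:Z + 2) G'].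
have [||||||u [Wu hu Eu uE [G' duE [DG' hG']]]] := @span_Prod _ _ charF p s W1 (pd a0 f) us szs.
- exact: supp_pd.
- by apply: homog_pd hf; lia.
- by rewrite -pd_eps Ef linear0.
- split.
    exists 0; split; rewrite ?linear0 //; first by case: clW.
      exact: homog0.
    by exists 0; rewrite ?linear0 //; split=> //; apply: homog0.
  move=> c g1 g2 [u1 [Wu1 hu1 Eu1 uE1 [G1 dE1 [DG1 hG1]]]] [u2 [Wu2 hu2 Eu2 uE2 [G2 dE2 [DG2 hG2]]]].
  exists (c *: u1 + u2); split.
  + by case: clW => _; apply.
  + by apply: homogD => //; apply: homogZ.
  + by rewrite linearP /= Eu1 Eu2 scaler0 addr0.
  + by rewrite linearP /= uE1 uE2.
  exists (c *: G1 + G2); first by rewrite !linearP /= dE1 dE2.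
  by rewrite linearP /= DG1 DG2 scaler0 addr0; split=> //; apply: homogD => //; apply: homogZ.
- move=> ps ups sub szps.
  have [r pr] := uniq_extend us ups sub.
  have := perm_size pr; rewrite size_cat szs size_flat szps.
  case: r pr => [|b [|d r]] pr /=; try lia; move=> _.
  have nb : b \notin flat ps.
    by have := perm_uniq pr; rewrite us cat_uniq /= orbF => /esym/and3P[].
  have sb : b \in s by rewrite (perm_mem pr) mem_cat mem_head orbT.
  have na : a0 \notin flat ps by apply: contra na0; apply: sub.
  have ups' : uniq (flat ((a0, b) :: ps)).
    rewrite /= inE negb_or na nb ups !andbT.
    by apply: contraNneq na0 => ->.
  exists (Prod F ((a0, b) :: ps)); split.
  + by apply: WP => //=; rewrite szps.
  + by apply: homog_Prod; rewrite /= szps -addn1 PoszD.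
  + exact: eps_Prod.
  + rewrite linearD /= pd_xmE // pd_xm_neq ?supp_Prod // ?linear0 ?addr0 //.
    by apply: contraNneq na0 => ->.
  by exists 0; rewrite ?linear0 ?del_Prod //; split=> //; apply: homog0.
- move=> h sh hh.
  have hx : homog (p%:Z + 3) (xm a0 h) by apply: homog_xm hh; lia.
  exists (E (xm a0 h)); split.
  + by apply: Wb; [apply: supp_enum | move: hx; rewrite (_ : p%:Z + 3 = p%:Z + 1 + 2) //; lia].
  + by apply: homog_eps hx; lia.
  + exact: epsF2.
  + by rewrite pd_eps pd_xmE // sh // linear0 addr0.
  by exists (D (xm a0 h)); rewrite ?del_eps //; split; [apply: delF2 | apply: homog_del hx; lia].
have pf0 : pd a0 (f + u) = 0 by rewrite linearD /= uE addv2.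
have sfu : supp s (f + u) by apply: supp_of_pd0 pf0.
have dfu : D (f + u) = E (G + G') by rewrite linearD /= fE duE linearD.
have DGG : D (G + G') = 0 by rewrite linearD /= DG DG' addr0.
have dfu0 : D (f + u) = E (co0 a0 (G + G')).
  have sD : pd a0 (D (f + u)) = 0 by rewrite pd_del pf0 linear0.
  by rewrite -(co0_id sD) dfu eps_co0 // -pd_del DGG linear0 addr0.
have [|||q [sq hq qE]] := @del_inj _ _ charF p s (f + u) us szs sfu.
- exact: homogD.
- by rewrite linearD /= Ef Eu addr0.
- by exists (co0 a0 (G + G')); split=> //; [apply: supp_pd_xm | apply: (homog_co0 charF); apply: homogD].
have -> : f = u + E q by rewrite -qE; char2 charF.
by apply: lin_closedD => //; apply: Wb => //; apply: supp_enum.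
Qed.

End Chains.

(** * Row vectors as square-free polynomials *)

Section UpSums.

Variables (F : fieldType) (T : finType).
Local Notation Lam := {ffun {set T} -> F^o}.
Implicit Types (f : Lam) (s : seq T) (a : T) (r : nat).

(** For a list without repetition, the closed form of e_r of the derivations in [s]; it links the
    recursive [del] and [eps] to [incl_mx]. *)
Definition up_sum r s f : Lam :=
  [ffun X : {set T} => \sum_(Y : {set T} | [&& X \subset Y,
     [forall (x | x \in Y :\: X), x \in s] & #|Y :\: X| == r]) f Y].

Lemma up_sum0 s f : up_sum 0 s f = f.
Proof.
apply/ffunP=> X; rewrite ffunE (big_pred1 X) // => Y /=.
apply/and3P/eqP => [[XY _]|->].
  rewrite cards_eq0 setD_eq0 => YX; apply/eqP.
  by rewrite eqEsubset YX.
by rewrite subxx setDv cards0; split=> //; apply/forall_inP => x; rewrite inE.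
Qed.

Lemma up_sum_nil r f : up_sum r.+1 [::] f = 0.
Proof.
apply/ffunP=> X; rewrite !ffunE big1 // => Y /and3P[_ /forall_inP nY cY].
suff D0 : Y :\: X = set0 by rewrite D0 cards0 in cY.
by apply/setP=> x; rewrite in_set0; apply/negP => /nY.
Qed.

Lemma up_sum_cons r a s f : a \notin s ->
  up_sum r.+1 (a :: s) f = up_sum r.+1 s f + pd a (up_sum r s f).
Proof.
move=> na; apply/ffunP=> X; rewrite !ffunE (bigID (fun Y => a \in Y :\: X)) /= addrC.
congr (_ + _).
  apply: eq_bigl => Y; rewrite andbC.
  apply/andP/and3P => [[aY /and3P[-> /forall_inP sY ->]]|[-> /forall_inP sY ->]].
    split=> //; apply/forall_inP => x xY; have := sY x xY; rewrite inE => /predU1P[xa|//].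
    by rewrite -xa xY in aY.
  split; first by apply: contra na => /sY.
  by rewrite andbT /=; apply/forall_inP => x /sY; rewrite inE orbC => ->.
case: ifP => aX; first by rewrite big1 // => Y /andP[_]; rewrite inE aX.
apply: eq_bigl => Y.
have [aY|naY] /= := boolP (a \in Y); last first.
  by rewrite inE (negPf naY) andbF andbF; apply/esym/negbTE; rewrite subUset sub1set (negPf naY).
rewrite in_setD aX aY /= andbT subUset sub1set aY /=.
congr (_ && _).
have YE : Y :\: X = a |: (Y :\: (a |: X)).
  by apply/setP=> x; rewrite !inE; case: (x =P a) => [->|]; rewrite ?aX ?aY.
congr (_ && _); last by rewrite YE cardsU1 !inE eqxx /= add1n eqSS.
apply/forall_inP/forall_inP => sY x xY.
  have := sY x; rewrite YE setU1r // inE => /(_ isT) /predU1P[xa|//].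
  by move: xY; rewrite xa !inE eqxx.
by move: xY; rewrite YE => /setU1P[->|/sY xs]; rewrite ?mem_head // inE xs orbT.
Qed.

Lemma del_up_sum s f : uniq s -> del s f = up_sum 1 s f.
Proof.
elim: s => [|a s IH] /=; first by rewrite up_sum_nil.
by case/andP=> na us; rewrite IH // up_sum_cons // up_sum0.
Qed.

Lemma eps_up_sum s f : uniq s -> eps s f = up_sum 2 s f.
Proof.
elim: s => [|a s IH] /=; first by rewrite up_sum_nil.
by case/andP=> na us; rewrite IH // up_sum_cons // del_up_sum.
Qed.

End UpSums.

Section Bridge.

Variables (F : fieldType) (n : nat).
Local Notation T := 'I_n.
Local Notation Lam := {ffun {set T} -> F^o}.
Local Notation D := (@del F T (enum T)).
Local Notation E := (@eps F T (enum T)).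
Implicit Types (f : Lam) (k : int) (m : nat).

(** Extension by zero puts the rows of all degrees into one algebra; [psi k] reads off the degree k
    part and inverts [phi] on [homog k]. *)
Definition phi k (v : 'rV[F]_#|Omega n k|) : Lam :=
  [ffun X : {set T} => \sum_i v 0 i * (kset i == X)%:R].
Definition psi k f : 'rV[F]_#|Omega n k| := \row_i f (kset i).

Lemma phi_is_linear k : linear (@phi k).
Proof.
move=> c u v; apply/ffunP => X; rewrite !ffunE.
transitivity (c * (\sum_i u 0 i * (kset i == X)%:R) +
  \sum_i v 0 i * (kset i == X)%:R); last by [].
rewrite mulr_sumr -big_split; apply: eq_bigr => i _.
by rewrite !mxE mulrDl mulrA.
Qed.
HB.instance Definition _ k := GRing.isLinear.Build F _ Lam _ (@phi k) (@phi_is_linear k).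

Lemma psi_is_linear k : linear (@psi k).
Proof. by move=> c f g; apply/rowP => i; rewrite !mxE !ffunE. Qed.
HB.instance Definition _ k := GRing.isLinear.Build F Lam _ _ (@psi k) (@psi_is_linear k).

Lemma phi_kset k (v : 'rV_#|Omega n k|) i : phi v (kset i) = v 0 i.
Proof.
rewrite ffunE (bigD1 i) //= eqxx mulr1 big1 ?addr0 // => j ne.
by rewrite (inj_eq (@kset_inj _ _)) (negPf ne) mulr0.
Qed.

Lemma phiK k : cancel (@phi k) (@psi k).
Proof. by move=> v; apply/rowP => i; rewrite mxE phi_kset. Qed.

Lemma homog_phi k (v : 'rV_#|Omega n k|) : homog k (phi v).
Proof.
move=> X nX; apply/eqP; apply: contraNT nX => ne.
rewrite ffunE big1 // => i _; case: eqP => [iX|]; last by rewrite mulr0.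
by rewrite -iX card_kset eqxx in ne.
Qed.

Lemma homog_eq k f g : homog k f -> homog k g ->
  (forall i : 'I_#|Omega n k|, f (kset i) = g (kset i)) -> f = g.
Proof.
move=> hf hg e; apply/ffunP => X; have [kX|nX] := boolP (X \in Omega n k).
  by have [i <-] := kset_ex kX.
have z h : homog k h -> h X = 0.
  move=> hh; apply/eqP; apply: contraNT nX => /hh <-.
  by rewrite inE.
by rewrite !z.
Qed.

Lemma psiK k f : homog k f -> phi (psi k f) = f.
Proof.
move=> hf; apply: (@homog_eq k) => // [|i]; first exact: homog_phi.
by rewrite phi_kset mxE.
Qed.

Lemma phi_inj k : injective (@phi k). Proof. exact: can_inj (@phiK k). Qed.

Lemma phi_eq0 k (v : 'rV_#|Omega n k|) : phi v = 0 -> v = 0.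
Proof. by move=> v0; apply: phi_inj; rewrite v0 linear0. Qed.

Lemma up_sum_phi j k (r : nat) (v : 'rV_#|Omega n j|) i : j = k + r%:Z ->
  up_sum r (enum T) (phi v) (kset i) = (v *m incl_mx n F j k) 0 i.
Proof.
move=> ejk; rewrite ffunE mxE.
under eq_bigr do rewrite ffunE.
rewrite exchange_big /=; apply: eq_bigr => l _; rewrite incl_mxE.
have [sub|nsub] := boolP (_ \subset _).
  rewrite mulr1 (bigD1 (kset l)) /= ?eqxx ?mulr1.
    by rewrite big1 ?addr0 // => Y /andP[_]; rewrite eq_sym => /negPf->; rewrite mulr0.
  rewrite sub /=; apply/andP; split; first by apply/forall_inP => x _; rewrite mem_enum.
  rewrite cardsD (setIidPr sub); have := card_kset l; have := card_kset i.
  have := subset_leq_card sub; move: (#|_|) (#|_|) => x y; lia.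
rewrite mulr0 big1 // => Y /andP[iY _]; case: eqP => [lY|]; last by rewrite mulr0.
by rewrite lY iY in nsub.
Qed.

Hypothesis charF : 2%N \in [pchar F].

Lemma phi_del j k (v : 'rV_#|Omega n j|) : j = k + 1 ->
  phi (v *m incl_mx n F j k) = D (phi v).
Proof.
move=> e; apply: (@homog_eq k) => [||i]; first exact: homog_phi.
  by apply: (homog_del _ (@homog_phi _ v)); lia.
by rewrite phi_kset del_up_sum ?enum_uniq // (@up_sum_phi j k).
Qed.

Lemma phi_eps j k (v : 'rV_#|Omega n j|) : j = k + 2 ->
  phi (v *m incl_mx n F j k) = E (phi v).
Proof.
move=> e; apply: (@homog_eq k) => [||i]; first exact: homog_phi.
  by apply: (homog_eps _ (@homog_phi _ v)); lia.
by rewrite phi_kset eps_up_sum ?enum_uniq // (@up_sum_phi j k).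
Qed.

Lemma phi_perm k (t : 'S_n) (v : 'rV_#|Omega n k|) :
  phi (v *m perm_mod n F k t) = permute t (phi v).
Proof.
apply: (@homog_eq k) => [||i]; [exact: homog_phi | exact: (homog_permute (@homog_phi _ v)) |].
rewrite phi_kset mxE !ffunE; apply: eq_bigr => l _; rewrite perm_mod_mxE.
congr (_ * (_ : bool)%:R); apply/eqP/eqP => ->.
  by apply/setP=> x; rewrite inE mem_imset //; apply: perm_inj.
apply/setP=> x; apply/idP/imsetP => [xi|[y]]; last by rewrite inE => yi ->.
by exists (t^-1%g x); rewrite ?inE permKV.
Qed.

Lemma psi_perm k (t : 'S_n) f : homog k f ->
  psi k f *m perm_mod n F k t = psi k (permute t f).
Proof. by move=> hf; apply: phi_inj; rewrite phi_perm !psiK //; apply: homog_permute. Qed.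

Lemma sub_ker_eps k (u : 'rV_#|Omega n k|) :
  (u <= ker_eps n F k)%MS <-> E (phi u) = 0.
Proof.
have e : k = k - 2 + 2 by rewrite subrK.
split=> [/sub_kermxP u0|]; first by rewrite -(@phi_eps k (k - 2)) // u0 linear0.
by rewrite -(@phi_eps k (k - 2)) // => /phi_eq0/sub_kermxP.
Qed.

Lemma sub_im_eps k (u : 'rV_#|Omega n k|) :
  (u <= im_eps n F k)%MS <-> bounds (enum T) k (phi u).
Proof.
rewrite genmxE; split=> [/submxP[w ->]|[h [_ hh uE]]].
  by exists (phi w); rewrite phi_eps //; split=> //; [apply: supp_enum | apply: homog_phi].
apply/submxP; exists (psi (k + 2) h); apply: phi_inj.
by rewrite phi_eps // psiK.
Qed.

Lemma row_pred_closed k d (M : 'M[F]_(d, #|Omega n k|)) :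
  lin_closed (fun f => (psi k f <= M)%MS).
Proof.
split=> [|c f g sf sg]; first by rewrite linear0 sub0mx.
by rewrite linearP addmx_sub // scalemx_sub.
Qed.

Lemma cyclic_ind k (v : 'rV_#|Omega n k|) (W : Lam -> Prop) : lin_closed W ->
  (forall t : 'S_n, W (permute t (phi v))) ->
  forall u, (u <= cyclic_mx (perm_mod n F k) v)%MS -> W (phi u).
Proof.
case=> W0 cW Wv u /cyclic_mxP[A /envelop_mxP[c ->] ->].
rewrite mulmx_sumr linear_sum; elim/big_rec: _ => // t g _ Wg.
by rewrite -scalemxAr linearZ /= phi_perm; apply: cW.
Qed.

End Bridge.

(** * Generators of the Specht modules and the vectors [v_vec] *)

Section UniqLists.

Variable T : finType.
Implicit Types (s r : seq T) (ps : seq (T * T)).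

Lemma perm_of_uniq s r : uniq s -> uniq r -> size s = size r ->
  exists t : {perm T}, map t s = r.
Proof.
move=> us ur szr.
have [s0|[x0 _]] : s = [::] \/ exists x0, x0 \in s.
- by case: (s) => [|x0 s0]; [left | right; exists x0; rewrite mem_head].
- by move: szr; rewrite s0; case: (r) => // _; exists 1%g.
have [|s' ps] := uniq_extend (enum_uniq T) us; first by move=> x; rewrite mem_enum.
have [|r' pr] := uniq_extend (enum_uniq T) ur; first by move=> x; rewrite mem_enum.
have szE : size (s ++ s') = size (r ++ r') by rewrite -(perm_size ps) (perm_size pr).
have uss : uniq (s ++ s') by rewrite -(perm_uniq ps) enum_uniq.
have urr : uniq (r ++ r') by rewrite -(perm_uniq pr) enum_uniq.
have ms x : x \in s ++ s' by rewrite -(perm_mem ps) mem_enum.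
pose g x := nth x (r ++ r') (index x (s ++ s')).
have lt x : (index x (s ++ s') < size (r ++ r'))%N by rewrite -szE index_mem.
have inj_g : injective g.
  move=> x y; rewrite /g (set_nth_default x y) // => /eqP.
  rewrite nth_uniq // => /eqP e.
  by rewrite -(nth_index x (ms x)) e nth_index.
exists (perm inj_g).
apply: (@eq_from_nth _ x0); rewrite size_map // => i li.
rewrite (nth_map x0) // permE /g (set_nth_default x0) //.
by rewrite index_cat mem_nth // index_uniq // nth_cat -szr li.
Qed.

Lemma flat_inj : injective (@flat T).
Proof.
elim=> [|[a b] ps IH] [|[c d] qs] //= [-> -> e].
by rewrite (IH _ e).
Qed.

Lemma map2_of_uniq ps qs : uniq (flat ps) -> uniq (flat qs) -> size ps = size qs ->
  exists t : {perm T}, map2 t ps = qs.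
Proof.
move=> up uq sz; have [|t e] := perm_of_uniq up uq; first by rewrite !size_flat sz.
by exists t; apply: flat_inj; rewrite flat_map2.
Qed.

End UniqLists.

Section GroupSums.

Variable n : nat.
Local Notation T := 'I_n.
Implicit Types (k l : nat) (a b x : T).

Lemma Ggrp0 : Ggrp n 0 :=: [1]%g.
Proof.
rewrite /Ggrp /=; set A := [set _ | _ in _]; have -> : A = set0; last by rewrite gen0.
apply/setP=> t; rewrite in_set0; apply/negP => /imsetP[u].
by rewrite inE andbF.
Qed.

Lemma Ggrp_fix l x t : (l.*2 <= x)%N -> t \in Ggrp n l -> t x = x.
Proof.
move=> lx; suff /subsetP sub : Ggrp n l \subset 'C[x | 'P].
  by move=> /sub/astab1P.
rewrite gen_subG; apply/subsetP => s /imsetP[[a b]]; rewrite inE /=.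
move=> /and3P[oa al /eqP eb] ->; apply/astab1P; rewrite /= /aperm tpermD //.
  by apply/eqP => e; move: al lx; rewrite e; lia.
apply/eqP => e; move: oa al eb lx; rewrite -e => oa al eb lx.
have : odd b = ~~ odd a by rewrite eb.
by rewrite (negPf oa) => ob; have := odd_double l; lia.
Qed.

(** The transposition of [a] and [b] is an involution commuting with [Ggrp n l], which fixes both
    points; so the larger group is the disjoint union of the smaller one and one coset. *)
Lemma GgrpS l a b (V : nmodType) (f : {perm T} -> V) : a = l.*2 :> nat -> b = l.*2.+1 :> nat ->
  \sum_(t in Ggrp n l.+1) f t =
  \sum_(t in Ggrp n l) f t + \sum_(t in Ggrp n l) f (t * tperm a b)%g.
Proof.
move=> ea eb; have nab : a != b by apply/eqP => e; move: ea; rewrite e eb; lia.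
have fixG t : t \in Ggrp n l -> t a = a /\ t b = b.
  by move=> tG; split; apply: (@Ggrp_fix l); rewrite // ?ea ?eb.
have genE : Ggrp n l.+1 :=: (Ggrp n l <*> <[tperm a b]>)%g.
  rewrite joing_idl joing_idr /Ggrp /=; congr <<_>>%g; apply/setP => t.
  rewrite inE; apply/imsetP/orP => [[[c d]]|[/imsetP[[c d]]|/set1P->]].
  - rewrite inE /= => /and3P[oc cl /eqP dc] ->.
    have [lc|lc] := boolP (c < l.*2)%N.
      by left; apply/imsetP; exists (c, d); rewrite // inE /= oc lc dc eqxx.
    right; have ec : c = a.
      apply: val_inj; rewrite /= ea.
      have : val c <> l.*2.+1 by move=> e; move: oc; rewrite e /= odd_double.
      by move: lc cl; rewrite -leqNgt; lia.
    have -> : d = b by apply: val_inj; rewrite /= dc ec ea eb.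
    by rewrite ec inE.
  - rewrite inE /= => /and3P[oc cl dc] ->; exists (c, d); rewrite // inE /= oc dc andbT.
    by lia.
  exists (a, b); rewrite // inE /= ea eb odd_double eqxx andbT.
  by lia.
have cent : Ggrp n l \subset 'C(<[tperm a b]>).
  rewrite cent_cycle; apply/subsetP => t tG; apply/cent1P.
  have [ta tb] := fixG t tG.
  by apply: esym; rewrite conjgC tpermJ ta tb.
have ord2 : #[tperm a b] = 2.
  apply: cyclic.nt_prime_order; rewrite // ?expg2 ?tperm2 //.
  apply: contraNneq nab => /permP/(_ a); rewrite tpermL perm1 => ->.
  by [].
have GE : Ggrp n l.+1 :=: Ggrp n l :|: [set t * tperm a b | t in Ggrp n l]%g.
  by rewrite genE (cent_joinEl cent) /= (cycle2g ord2) mulgU mulg1 -rcosetE.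
set G := Ggrp n l in GE cent *.
have dis : [disjoint G & [set t * tperm a b | t in G]]%g.
  rewrite -setI_eq0; apply/eqP/setP => t; rewrite !inE; apply/negP => /andP[tG].
  case/imsetP => u uG tE; have [ta _] := fixG t tG; have [ua _] := fixG u uG.
  by move: ta; rewrite tE permM ua tpermL => ba; rewrite ba eqxx in nab.
rewrite (eq_bigl [predU G & [set t * tperm a b | t in G]%g]) => [|t]; last by rewrite GE inE.
rewrite bigU //=.
by congr (_ + _); rewrite big_imset // => u v _ _; apply: mulIg.
Qed.

End GroupSums.

Section Generators.

Variables (F : fieldType) (n : nat).
Hypothesis charF : 2%N \in [pchar F].
Local Notation T := 'I_n.
Local Notation Lam := {ffun {set T} -> F^o}.
Implicit Types (f : Lam) (k l m : nat) (r : seq T) (ps : seq (T * T)).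

Definition xms r f : Lam := foldr (@xm F T) f r.

Lemma xm_xms a r f : xm a (xms r f) = xms r (xm a f).
Proof. by elim: r => //= b r IH; rewrite xmC IH. Qed.

Lemma xmsD r f g : xms r (f + g) = xms r f + xms r g.
Proof. by elim: r => //= b r ->; rewrite linearD. Qed.

Lemma xms_rem b r f : b \in r -> xms r f = xm b (xms (rem b r) f).
Proof.
elim: r => //= c r IH; rewrite inE eq_sym; case: eqP => [-> //|_ /= br].
by rewrite {1}IH // xmC.
Qed.

Lemma pd_xms a r f : a \notin r -> pd a f = 0 -> pd a (xms r f) = 0.
Proof.
elim: r => //= c r IH; rewrite inE negb_or => /andP[ac ar] f0.
by rewrite pd_xm_neq // IH // linear0.
Qed.

Lemma xms_one r (Y : {set T}) : uniq r -> xms r (lam1 F T) Y = (Y == [set x in r])%:R.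
Proof.
elim: r Y => [|a r IH] Y /=; first by rewrite ffunE set_nil.
case/andP=> na ur; rewrite ffunE.
case: ifP => aY.
  rewrite IH //; congr ((_ : bool)%:R); apply/eqP/eqP => [e|->].
    by apply/setP=> x; have := congr1 (fun A : {set T} => x \in A) e; rewrite !inE; case: (x =P a) => [-> _|//]; rewrite aY.
  by apply/setP=> x; rewrite !inE; case: (x =P a) => [->|//]; rewrite (negPf na).
by case: eqP => // YE; rewrite YE inE mem_head in aY.
Qed.

Lemma card_evens k : (k.*2 <= n)%N -> #|evens n k| = k.
Proof.
move=> kn; have lt (i : 'I_k) : (i.*2.+1 < n)%N by have := ltn_ord i; lia.
have inj : injective (fun i => Ordinal (lt i)).
  by move=> i j /(congr1 val) /= e; apply: val_inj => /=; lia.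
rewrite -[RHS]card_ord -(card_imset _ inj); apply: eq_card => x.
rewrite inE; apply/andP/imsetP => [[ox xk]|[i _ ->]] /=; last first.
  by rewrite odd_double; have := ltn_ord i; split=> //; lia.
have xk2 : (x./2 < k)%N by rewrite -ltn_double; have := odd_double_half x; lia.
exists (Ordinal xk2) => //; apply: val_inj => /=.
by have := odd_double_half x; rewrite ox.
Qed.

Lemma phi_basis k (X : {set T}) : #|X| = k ->
  phi (basis_vec F k X) = [ffun Y => (Y == X)%:R] :> Lam.
Proof.
move=> cX; apply/ffunP=> Y; rewrite !ffunE.
have [|i iX] := @kset_ex n k X; first by rewrite inE cX.
rewrite (bigD1 i) //= mxE iX eqxx mul1r big1 ?addr0 1?eq_sym // => j ne.
by rewrite mxE -iX (inj_eq (@kset_inj _ _)) (negPf ne) mul0r.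
Qed.

(** Each new transposition replaces a factor x_b of the monomial by x_a + x_b; [r] lists the factors
    not yet replaced. Counting from 0, a = 2l and b = 2l + 1, so [b] is the even point 2l + 2. *)
Lemma phi_Gsum k l : (l <= k)%N -> (k.*2 <= n)%N -> exists ps r,
  [/\ size ps = l, uniq (flat ps), forall x, (x \in flat ps) = (x < l.*2)%N,
    uniq r /\ forall x, (x \in r) = [&& odd x, l.*2 <= x & x < k.*2]%N
    & phi (Gsum_vec n F k l) = xms r (Prod F ps)].
Proof.
move=> lk kn; elim: l lk => [|l IH] lk.
  exists [::], [seq x : T <- enum T | odd x && (x < k.*2)%N]; split=> //.
    split=> [|x]; first by apply: filter_uniq; apply: enum_uniq.
    by rewrite mem_filter mem_enum andbT.
  rewrite /Gsum_vec (eq_bigl (pred1 1%g)) => [|t]; last by rewrite Ggrp0 inE.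
  rewrite big_pred1_eq repr_mx1 mulmx1 phi_basis ?card_evens //.
  apply/ffunP => Y; rewrite ffunE xms_one; last by apply: filter_uniq; apply: enum_uniq.
  suff -> : evens n k = [set x in [seq x : T <- enum T | odd x && (x < k.*2)%N]] by [].
  by apply/setP=> x; rewrite !inE mem_filter mem_enum andbT.
have [|ps [r [szps ups mps [ur mr] e]]] := IH; first lia.
have lta : (l.*2 < n)%N by lia.
have ltb : (l.*2.+1 < n)%N by lia.
pose a := Ordinal lta; pose b := Ordinal ltb.
have br : b \in r by rewrite mr /= odd_double /=; lia.
have nar : a \notin r by rewrite mr /= odd_double.
have nab : a != b by apply/eqP => /(congr1 val) /=; lia.
have nap : a \notin flat ps by rewrite mps /= ltnn.
have nbp : b \notin flat ps by rewrite mps /=; lia.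
exists ((a, b) :: ps), (rem b r); split.
- by rewrite /= szps.
- by rewrite /= inE negb_or nab nap nbp.
- move=> x; rewrite !inE mps -!val_eqE /=; lia.
- split=> [|x]; first exact: rem_uniq.
  rewrite (mem_rem_uniq b ur) !inE mr -val_eqE /=.
  apply/idP/idP; last by lia.
  case/and4P=> xb ox lx xk; rewrite ox xk andbT /=.
  have : val x <> l.*2 by move=> xl; move: ox; rewrite xl odd_double.
  by move: xb => /eqP; lia.
rewrite /Gsum_vec (@GgrpS _ l a b) // mulmxDr linearD /=.
have -> : \sum_(t in Ggrp n l) perm_mod n F k (t * tperm a b)%g =
    (\sum_(t in Ggrp n l) perm_mod n F k t) *m perm_mod n F k (tperm a b).
  by rewrite mulmx_suml; apply: eq_bigr => t _; rewrite repr_mxM ?inE.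
rewrite mulmxA phi_perm // -/(Gsum_vec n F k l) e (xms_rem _ br).
rewrite permute_xm tpermR permute_tperm; first by rewrite addrC !xm_xms -xmsD.
- apply: pd_xms; last exact: supp_Prod.
  by apply: contra nar; apply: mem_rem.
apply: pd_xms; last exact: supp_Prod.
by rewrite mem_rem_uniqF.
Qed.

Lemma phi_Specht_gen k : (k.*2 <= n)%N -> exists ps,
  [/\ uniq (flat ps), size ps = k & phi (Gsum_vec n F k k) = Prod F ps].
Proof.
move=> kn; have [ps [r [szps ups _ [_ mr] e]]] := phi_Gsum (leqnn k) kn.
exists ps; split=> //; rewrite e; case: r mr {e} => // x r mr.
by have := mr x; rewrite mem_head; lia.
Qed.

Lemma phi_v k : (k.*2 <= n)%N -> vform (enum T) k (phi (v_vec n F k)).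
Proof.
case: k => [|k] kn.
  have [ps [_ szps e]] := phi_Specht_gen kn.
  by case: ps szps e => //= _ ->.
have [ps [r [szps ups mps [ur mr] e]]] := phi_Gsum (leqnSn k) kn.
have ltb : (k.*2.+1 < n)%N by lia.
pose b := Ordinal ltb.
have br : b \in r by rewrite mr /= odd_double /=; lia.
exists b, ps; split=> //.
- by rewrite /= ups mps /= -leqNgt; lia.
- by move=> x; rewrite mem_enum.
rewrite /v_vec /= e (xms_rem _ br).
suff -> : rem b r = [::] by [].
case rE : (rem b r) => [//|x r'].
have : x \in rem b r by rewrite rE mem_head.
rewrite (mem_rem_uniq b ur) !inE mr -val_eqE /=.
case/and4P=> /eqP xb ox lx xk; have : val x <> k.*2 by move=> xl; move: ox; rewrite xl odd_double.
by lia.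
Qed.

Lemma Prod_in_Specht k ps : (k.*2 <= n)%N -> uniq (flat ps) -> size ps = k ->
  (psi k (Prod F ps) <= Specht n F k)%MS.
Proof.
move=> kn ups szps; have [qs [uqs szqs e]] := phi_Specht_gen kn.
have [|t te] := map2_of_uniq uqs ups; first by rewrite szps.
have -> : psi k (Prod F ps) = Gsum_vec n F k k *m perm_mod n F k t.
  by apply: phi_inj; rewrite phi_perm e permute_Prod te psiK //; apply: homog_Prod; rewrite szps.
by apply: mxmodule_trans; rewrite ?inE ?cyclic_mx_id ?cyclic_mx_module.
Qed.

Lemma Specht_ind k (W : Lam -> Prop) : (k.*2 <= n)%N -> lin_closed W ->
  (forall ps, uniq (flat ps) -> size ps = k -> W (Prod F ps)) ->
  forall u, (u <= Specht n F k)%MS -> W (phi u).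
Proof.
move=> kn clW WP; apply: cyclic_ind => // t.
have [qs [uqs szqs ->]] := phi_Specht_gen kn; rewrite permute_Prod; apply: WP.
  by rewrite flat_map2 (map_inj_uniq perm_inj).
by rewrite size_map.
Qed.

Lemma vform_permute k f : (k.*2 <= n)%N -> vform (enum T) k f ->
  exists t : 'S_n, permute t (phi (v_vec n F k)) = f.
Proof.
move=> kn vf; have vv := phi_v kn.
case: k kn vf vv => [|k] kn; first by move=> -> ->; exists 1%g; rewrite permute_one.
case=> b [ps [ups _ szps ->]] [c [qs [uqs _ szqs ->]]].
have [|t /= [tc tqs]] := perm_of_uniq uqs ups; first by rewrite /= !size_flat szps szqs.
exists t; rewrite permute_xm permute_Prod tc; congr (xm _ (Prod _ _)).
by apply: flat_inj; rewrite flat_map2.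
Qed.

Lemma pairing_psi k ps (u : 'rV_#|Omega n k|) :
  (u *m (psi k (Prod F ps))^T) 0 0 = pairing ps (phi u).
Proof.
rewrite pairing_coord mxE.
under [RHS]eq_bigr do rewrite ffunE mulr_suml.
rewrite exchange_big; apply: eq_bigr => i _; rewrite !mxE.
rewrite (bigD1 (kset i)) //= eqxx mulr1 big1 ?addr0 // => Y ne.
by rewrite eq_sym (negPf ne) mulr0; apply: mul0r.
Qed.

(** The Specht module is spanned by the polytabloids, and [pairing_psi] turns the form against them
    into [pairing]. *)
Lemma sub_orth_Specht k (u : 'rV_#|Omega n k|) : (k.*2 <= n)%N ->
  (u <= orth (Specht n F k))%MS <-> perp (enum T) k (phi u).
Proof.
move=> kn; split=> [/sub_kermxP u0 ps ups _ szps|pu].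
  rewrite -pairing_psi; have /submxP[A ->] := Prod_in_Specht kn ups szps.
  by rewrite trmx_mul mulmxA u0 mul0mx mxE.
apply/sub_kermxP/trmx_inj; rewrite trmx_mul trmxK trmx0.
apply/row_matrixP => i; rewrite row_mul row0.
have := row_sub i (Specht n F k); move: (row i _) => w wS.
pose W f := psi k f *m u^T = 0.
have : W (phi w); last by rewrite /W phiK.
apply: (Specht_ind kn _ _ wS); first split.
- by rewrite /W linear0 mul0mx.
- by move=> c f g Wf Wg; rewrite /W linearP /= mulmxDl -scalemxAl Wf Wg scaler0 addr0.
move=> ps ups szps; apply/trmx_inj; rewrite trmx_mul trmxK trmx0.
apply/matrixP => x y; rewrite !ord1 pairing_psi mxE; apply: pu => //.
by move=> z; rewrite mem_enum.
Qed.

End Generators.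

(** * The largest point and its stabiliser *)

Section LastPoint.

Variables (F : fieldType) (n : nat).
Local Notation Lam := {ffun {set 'I_n} -> F^o}.
Local Notation Lam1 := {ffun {set 'I_n.+1} -> F^o}.
Local Notation top := (@ord_max n).
Local Notation up := (lift top).
Implicit Types (f : Lam) (g : Lam1) (k : int) (s : seq 'I_n).

(** This sets the last variable to zero, while [incl] views a polynomial in the other variables as
    one on all points. *)
Definition rest g : Lam := [ffun X : {set 'I_n} => g (up @: X)].
Definition incl f : Lam1 :=
  [ffun Y : {set 'I_n.+1} => if top \in Y then 0 else f (up @^-1: Y)].

Lemma rest_is_linear : linear rest.
Proof. by move=> c f g; apply/ffunP => X; rewrite !ffunE. Qed.
HB.instance Definition _ := GRing.isLinear.Build F Lam1 Lam _ rest rest_is_linear.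

Lemma incl_is_linear : linear incl.
Proof.
move=> c f g; apply/ffunP => X; rewrite !ffunE.
by case: ifP => _ //; rewrite scaler0 addr0.
Qed.
HB.instance Definition _ := GRing.isLinear.Build F Lam Lam1 _ incl incl_is_linear.

Lemma preim_up_imset (X : {set 'I_n}) : up @^-1: (up @: X) = X.
Proof. by apply/setP=> x; rewrite inE mem_imset //; apply: lift_inj. Qed.

Lemma top_imset_up (X : {set 'I_n}) : (top \in up @: X) = false.
Proof. by apply/imsetP => -[x _] /eqP; rewrite (negPf (neq_lift _ _)). Qed.

Lemma inclK : cancel incl rest.
Proof. by move=> f; apply/ffunP => X; rewrite !ffunE top_imset_up preim_up_imset. Qed.

Lemma restK g : pd top g = 0 -> incl (rest g) = g.
Proof.
move=> g0; apply/ffunP => Y; rewrite !ffunE; case: ifP => tY.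
  by rewrite (pd0_val g0 tY).
congr (g _); apply/setP => x; apply/imsetP/idP => [[y]|xY].
  by rewrite inE => yY ->.
have [y xy|xt] := unliftP top x; first by exists y; rewrite // inE -xy.
by rewrite xt tY in xY.
Qed.

Lemma pd_top_incl f : pd top (incl f) = 0.
Proof. by apply/ffunP => Y; rewrite !ffunE setU11 if_same. Qed.

Lemma rest_pd a g : rest (pd (up a) g) = pd a (rest g).
Proof.
apply/ffunP => X; rewrite !ffunE mem_imset; last exact: lift_inj.
by rewrite imsetU1.
Qed.

Lemma rest_xm_top g : rest (xm top g) = 0.
Proof. by apply/ffunP => X; rewrite !ffunE top_imset_up. Qed.

Lemma rest_xm a g : rest (xm (up a) g) = xm a (rest g).
Proof.
apply/ffunP => X; rewrite !ffunE mem_imset; last exact: lift_inj.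
case: ifP => // _; congr (g _); apply/setP => x; rewrite !inE.
have [y ->|->] := unliftP top x; last by rewrite !top_imset_up andbF.
by rewrite !mem_imset ?inE ?(inj_eq lift_inj) //; apply: lift_inj.
Qed.

Lemma rest_one : rest (lam1 F _) = lam1 F _.
Proof. by apply/ffunP => X; rewrite !ffunE imset_eq0. Qed.

Lemma rest_del s g : rest (del (map up s) g) = del s (rest g).
Proof. by elim: s => [|a s IH] /=; rewrite ?linear0 // linearD /= IH rest_pd. Qed.

Lemma rest_eps s g : rest (eps (map up s) g) = eps s (rest g).
Proof. by elim: s => [|a s IH] /=; rewrite ?linear0 // linearD /= IH rest_pd rest_del. Qed.

Lemma rest_Prod ps : rest (Prod F [seq (up p.1, up p.2) | p <- ps]) = Prod F ps.
Proof. by elim: ps => [|p ps IH] /=; rewrite ?rest_one // linearD /= !rest_xm IH. Qed.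

Lemma flat_up (ps : seq ('I_n * 'I_n)) :
  flat [seq (up p.1, up p.2) | p <- ps] = map up (flat ps).
Proof. by elim: ps => //= p ps ->. Qed.

Definition ups := map up (enum 'I_n).

Lemma top_notin_ups : top \notin ups.
Proof. by apply/mapP => -[x _] /eqP; rewrite (negPf (neq_lift _ _)). Qed.

Lemma uniq_ups : uniq ups.
Proof. by rewrite map_inj_uniq ?enum_uniq //; apply: lift_inj. Qed.

Lemma size_ups : size ups = n.
Proof. by rewrite size_map size_enum_ord. Qed.

Lemma perm_top : perm_eq (enum 'I_n.+1) (top :: ups).
Proof.
apply: uniq_perm; rewrite ?enum_uniq //= ?top_notin_ups ?uniq_ups // => x.
rewrite mem_enum in_cons; have [y ->|->] := unliftP top x; last by rewrite eqxx.
by rewrite map_f ?orbT // mem_enum.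
Qed.

Lemma supp_incl f : supp ups (incl f).
Proof.
move=> a; have [b ->|-> _] := unliftP top a; last exact: pd_top_incl.
by rewrite map_f // mem_enum.
Qed.

Lemma homog_incl k f : homog k f -> homog k (incl f).
Proof.
move=> hf Y; rewrite ffunE; case: ifP => [_|tY /hf <-]; first by rewrite eqxx.
congr (_ %:Z); rewrite -[RHS](card_imset _ (@lift_inj _ top)).
apply: eq_card => x; apply/idP/imsetP => [xY|[y]]; last by rewrite inE => yY ->.
have [y xy|xt] := unliftP top x; first by exists y; rewrite // inE -xy.
by rewrite xt tY in xY.
Qed.

Lemma homog_rest k g : homog k g -> homog k (rest g).
Proof. by move=> hg X; rewrite ffunE => /hg <-; rewrite card_imset //; apply: lift_inj. Qed.

Lemma rest_epsF g : supp ups g ->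
  rest (eps (enum 'I_n.+1) g) = eps (enum 'I_n) (rest g).
Proof. by move=> sg; rewrite (eps_supp uniq_ups sg) rest_eps. Qed.

Lemma incl_epsF f : incl (eps (enum 'I_n) f) = eps (enum 'I_n.+1) (incl f).
Proof.
rewrite -{1}(inclK f) -rest_epsF; last exact: supp_incl.
by rewrite restK // pd_eps pd_top_incl linear0.
Qed.

Lemma bounds_incl k f : bounds ups k (incl f) <-> bounds (enum 'I_n) k f.
Proof.
split=> [[h [sh hh e]]|[h [_ hh ->]]].
  exists (rest h); split; [exact: supp_enum | exact: homog_rest |].
  by rewrite -rest_epsF // -e inclK.
exists (incl h); split; [exact: supp_incl | exact: homog_incl |].
exact: incl_epsF.
Qed.

Lemma imset_lift_perm (t : 'S_n) (X : {set 'I_n}) :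
  lift_perm top top t @^-1: (up @: X) = up @: (t @^-1: X).
Proof.
apply/setP => x; rewrite inE; have [y ->|->] := unliftP top x.
  by rewrite lift_perm_lift !mem_imset ?inE //; apply: lift_inj.
by rewrite lift_perm_id !top_imset_up.
Qed.

Lemma rest_permute (t : 'S_n) g :
  rest (permute (lift_perm top top t) g) = permute t (rest g).
Proof. by apply/ffunP => X; rewrite !ffunE imset_lift_perm. Qed.

Lemma incl_permute (t : 'S_n) f :
  incl (permute t f) = permute (lift_perm top top t) (incl f).
Proof.
rewrite -{1}(inclK f) -rest_permute restK //.
by rewrite -{1}(lift_perm_id top top t) -permute_pd pd_top_incl linear0.
Qed.

End LastPoint.

(** * Subquotients *)

Section Sections.

Variables (F : fieldType) (gT : finGroupType) (G : {group gT}).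
Local Notation reprG := (mx_representation F G).

(* rH is isomorphic to V modulo the submodule of the rows satisfying P. *)
Definition is_section n (rG : reprG n) p (V : 'M[F]_(p, n)) (P : 'rV[F]_n -> Prop)
    d (rH : reprG d) : Prop :=
  mxmodule rG V /\ exists A : 'M[F]_(n, d), [/\
    forall x, x \in G -> forall v : 'rV_n, (v <= V)%MS -> v *m rG x *m A = v *m A *m rH x,
    forall v : 'rV_n, (v <= V)%MS -> v *m A = 0 <-> P v
    & forall w : 'rV_d, exists2 v : 'rV_n, (v <= V)%MS & w = v *m A].

Lemma is_section_repr n (rG : reprG n) (U V : 'M_n) (modU : mxmodule rG U)
    (modV : mxmodule rG V) :
  is_section rG V (fun v => (v <= U)%MS) (section_repr modU modV).
Proof.
pose S := <<in_factmod U V>>%MS.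
have inS (v : 'rV_n) : (v <= V)%MS -> (in_factmod U v <= S)%MS.
  by move=> sv; rewrite genmxE; apply: submxMr.
pose A := in_submod S (in_factmod U (1%:M : 'M_n)).
have AE (v : 'rV_n) : v *m A = in_submod S (in_factmod U v).
  by rewrite /A [in RHS]in_factmodE [in RHS]in_submodE -mulmxA -in_submodE.
split=> //; exists A; split=> [x Gx v sv | v sv | w].
- rewrite !AE (in_factmodJ modU) // -(in_submodJ (section_module modU modV)) //.
  exact: inS.
- rewrite AE; split=> [e|sU].
    rewrite -in_factmod_eq0 -(in_submodK (inS _ sv)) e.
    by rewrite linear0.
  by move: sU; rewrite -in_factmod_eq0 => /eqP ->; rewrite linear0.
have sS : (S <= in_factmod U V)%MS by rewrite genmxE.
have /submxP[D wD] := submx_trans (val_submodP w) sS; exists (D *m V); first exact: submxMl.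
rewrite AE; apply: (can_inj (@val_submodK _ _ S _)).
rewrite in_submodK; last by apply: inS; apply: submxMl.
by rewrite wD /in_factmod /= mulmxA.
Qed.

(** Preimages in [V] are chosen by [pinvmx]; equality of the kernels makes the resulting maps
    independent of the choice and inverse to each other. *)
Lemma is_section_rsim n (rG : reprG n) p (V : 'M_(p, n)) P1 P2 d1 (rH1 : reprG d1)
    d2 (rH2 : reprG d2) :
  is_section rG V P1 rH1 -> is_section rG V P2 rH2 ->
  (forall v : 'rV_n, (v <= V)%MS -> P1 v <-> P2 v) -> mx_rsim rH1 rH2.
Proof.
move=> [modV [A1 [hom1 ker1 sur1]]] [_ [A2 [hom2 ker2 sur2]]] eqP12.
have lemB d e (C1 : 'M[F]_(n, d)) (C2 : 'M[F]_(n, e)) :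
  (forall v : 'rV_n, (v <= V)%MS -> v *m C1 = 0 -> v *m C2 = 0) ->
  exists B, forall v : 'rV_n, (v <= V)%MS -> v *m C1 *m B = v *m C2.
  move=> k12; exists (pinvmx (V *m C1) *m V *m C2) => v sv.
  set w := v *m C1 *m pinvmx (V *m C1) *m V.
  have wC : w *m C1 = v *m C1.
    by rewrite /w -mulmxA mulmxKpV //; apply: submxMr.
  have -> : v *m C1 *m (pinvmx (V *m C1) *m V *m C2) = w *m C2 by rewrite /w -!mulmxA.
  apply/esym/eqP; rewrite -subr_eq0 -mulmxBl; apply/eqP; apply: k12.
    by rewrite addmx_sub // eqmx_opp submxMl.
  by rewrite mulmxBl wC subrr.
have [B BE] : exists B, forall v : 'rV_n, (v <= V)%MS -> v *m A1 *m B = v *m A2.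
  by apply: lemB => v sv /(ker1 v sv)/(eqP12 v sv)/(ker2 v sv).
have [C CE] : exists C, forall v : 'rV_n, (v <= V)%MS -> v *m A2 *m C = v *m A1.
  by apply: lemB => v sv /(ker2 v sv)/(eqP12 v sv)/(ker1 v sv).
have BC : B *m C = 1%:M.
  apply/row_matrixP => i; rewrite !rowE mulmxA mulmx1; have [v sv ->] := sur1 (delta_mx 0 i).
  by rewrite BE // CE.
have CB : C *m B = 1%:M.
  apply/row_matrixP => i; rewrite !rowE mulmxA mulmx1; have [v sv ->] := sur2 (delta_mx 0 i).
  by rewrite CE // BE.
have freeB : row_free B by apply/row_freeP; exists C.
exists B => //.
  apply/eqP; rewrite eqn_leq -{1}(eqP freeB) rank_leq_col /=.
  have freeC : row_free C by apply/row_freeP; exists B.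
  by rewrite -{1}(eqP freeC) rank_leq_col.
move=> x Gx; apply/row_matrixP => i; rewrite !rowE !mulmxA.
have [v sv ->] := sur1 (delta_mx 0 i).
have svx : (v *m rG x <= V)%MS by apply: mxmodule_trans.
by rewrite -hom1 // !BE // hom2.
Qed.

Lemma is_section_trans n (rG : reprG n) p (V : 'M_(p, n)) P d1 (rH1 : reprG d1)
    d2 (rH2 : reprG d2) :
  is_section rG V P rH1 -> mx_rsim rH1 rH2 -> is_section rG V P rH2.
Proof.
move=> [modV [A [homA kerA surA]]] [B e freeB homB].
have freeE (u : 'rV_d1) : u *m B = 0 -> u = 0.
  by move=> uB; apply: (row_free_inj freeB); rewrite uB mul0mx.
split=> //; exists (A *m B); split=> [x Gx v sv|v sv|w].
- by rewrite !mulmxA homA // -!mulmxA homB.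
- rewrite mulmxA -(kerA v sv); split=> [|->]; last by rewrite mul0mx.
  exact: freeE.
have fullB : row_full B by rewrite /row_full (eqP freeB) e.
have [v sv vE] := surA (w *m pinvmx B); exists v => //.
by rewrite mulmxA -vE mulmxKpV // submx_full.
Qed.

Lemma is_section_zero n (rG : reprG n) p (V : 'M_(p, n)) :
  mxmodule rG V -> is_section rG V (fun _ => True) (zero_mod F G).
Proof.
move=> modV; split=> //; exists 0; split=> [x _ v _|v _|w].
- by rewrite thinmx0 [RHS]thinmx0.
- by rewrite mulmx0.
by exists 0; rewrite ?sub0mx // thinmx0 mul0mx.
Qed.

(** A homomorphism that is onto modulo P2 induces an isomorphism of quotients. The identifications
    below write both modules as sections of one [V] and then compare kernels. *)
Lemma is_section_preim n1 n2 (rG1 : reprG n1) (rG2 : reprG n2) p1 p2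
    (V1 : 'M_(p1, n1)) (V2 : 'M_(p2, n2)) P2 d (rH : reprG d) (B : 'M_(n1, n2)) :
    is_section rG2 V2 P2 rH -> mxmodule rG1 V1 ->
    (forall x, x \in G -> forall v : 'rV_n1, (v <= V1)%MS ->
       v *m rG1 x *m B = v *m B *m rG2 x) ->
    (forall v : 'rV_n1, (v <= V1)%MS -> (v *m B <= V2)%MS) ->
    (forall w : 'rV_n2, (w <= V2)%MS ->
       exists2 v : 'rV_n1, (v <= V1)%MS & P2 (w - v *m B)) ->
  is_section rG1 V1 (fun v => P2 (v *m B)) rH.
Proof.
move=> [modV2 [A [homA kerA surA]]] modV1 homB sB surB.
split=> //; exists (B *m A); split=> [x Gx v sv|v sv|w].
- by rewrite !mulmxA homB // homA // sB.
- by rewrite mulmxA; apply: kerA; apply: sB.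
have [w2 sw2 ->] := surA w; have [v sv Pv] := surB w2 sw2; exists v => //.
apply/eqP; rewrite mulmxA -subr_eq0 -mulmxBl; apply/eqP.
by apply/kerA => //; rewrite addmx_sub // eqmx_opp sB.
Qed.

Definition preim_mx n1 n2 p (A : 'M[F]_(n1, n2)) (U : 'M_(p, n2)) : 'M_n1 :=
  kermx (A *m cokermx U).

Lemma sub_preim n1 n2 p q (A : 'M[F]_(n1, n2)) (U : 'M_(p, n2)) (M : 'M_(q, n1)) :
  (M <= preim_mx A U)%MS = (M *m A <= U)%MS.
Proof. by rewrite sub_kermx mulmxA submxE. Qed.

Lemma preim_module n1 n2 (rG1 : reprG n1) (rG2 : reprG n2) p (A : 'M_(n1, n2))
    (U : 'M_(p, n2)) :
  (forall x, x \in G -> rG1 x *m A = A *m rG2 x) -> mxmodule rG2 U ->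
  mxmodule rG1 (preim_mx A U).
Proof.
move=> homA modU; apply/mxmoduleP => x Gx; rewrite sub_preim -mulmxA homA // mulmxA.
by apply: mxmodule_trans => //; rewrite -sub_preim.
Qed.

(** The last hypothesis says that W/P is essential in V/P. The preimage M of a complement meets W
    only in P, hence lies in P, which forces V into W. *)
Lemma nonsplit_section n (rG : reprG n) (V W : 'M_n) P dE (rE : reprG dE)
    dA (rA : reprG dA) dB (rB : reprG dB) :
    is_section rG V P rE -> mxmodule rG W -> (W <= V)%MS ->
    (forall v : 'rV_n, (v <= V)%MS -> P v -> (v <= W)%MS) ->
    is_section rG W P rA -> is_section rG V (fun v => (v <= W)%MS) rB ->
    ~~ (V <= W)%MS ->
    (forall M : 'M_n, mxmodule rG M -> (M <= V)%MS ->
      (forall v : 'rV_n, (v <= M)%MS -> (v <= W)%MS -> P v) ->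
      forall v : 'rV_n, (v <= M)%MS -> P v) ->
  nonsplit_extension rE rB rA.
Proof.
move=> [modV [A [homA kerA surA]]] modW sWV PW secA secB nVW ess.
pose U := <<W *m A>>%MS.
have WA (w : 'rV_n) : (w <= W)%MS -> (w *m A <= U)%MS.
  by move=> sw; rewrite genmxE submxMr.
have UW (u : 'rV_dE) : (u <= U)%MS -> exists2 w : 'rV_n, (w <= W)%MS & u = w *m A.
  by rewrite genmxE => /submxP[D ->]; exists (D *m W); rewrite ?submxMl ?mulmxA.
have modU : mxmodule rE U.
  apply/mxmoduleP => x Gx; apply/row_subP => i; rewrite row_mul.
  have [w sw ->] := UW _ (row_sub i U).
  rewrite -homA ?(submx_trans sw) //; apply: WA.
  exact: mxmodule_trans.
exists U, modU; split.
- apply: (is_section_rsim (V := W) (P1 := P) _ secA) => //.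
  pose A' := A *m in_submod U 1%:M.
  have AE (v : 'rV_n) : v *m A' = in_submod U (v *m A).
    by rewrite [RHS]in_submodE -mulmxA.
  split=> //; exists A'; split=> [x Gx v sv|v sv|w].
  + by rewrite !AE homA ?(submx_trans sv) // -(in_submodJ modU) // WA.
  + rewrite AE -(kerA v (submx_trans sv sWV)); split=> [e|->]; last first.
      by rewrite linear0.
    by rewrite -(in_submodK (WA v sv)) e linear0.
  have [v sv vE] := UW _ (val_submodP w); exists v => //.
  by rewrite AE -vE val_submodK.
- apply: (is_section_rsim (V := V) (P1 := fun v => (v <= W)%MS) _ secB) => //.
  pose A' := A *m in_factmod U 1%:M.
  have AE (v : 'rV_n) : v *m A' = in_factmod U (v *m A).
    by rewrite [RHS]in_factmodE -mulmxA.
  split=> //; exists A'; split=> [x Gx v sv|v sv|w].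
  + by rewrite !AE homA // (in_factmodJ modU).
  + rewrite AE; split=> [/eqP|sw]; last first.
      by apply/eqP; rewrite in_factmod_eq0 WA.
    rewrite in_factmod_eq0 => /UW[w sw vw].
    have svw : (v - w <= V)%MS by rewrite addmx_sub // eqmx_opp (submx_trans sw).
    have : (v - w <= W)%MS.
      by apply: PW => //; apply/kerA; rewrite // mulmxBl vw subrr.
    by move=> svw'; rewrite -(subrK w v) addmx_sub.
  have [v sv vE] := surA (val_factmod w); exists v => //.
  by rewrite AE -vE val_factmodK.
case=> C modC defE dirUC.
have UC0 : (U :&: C = 0)%MS by apply/mxdirect_addsP.
pose M := (V :&: preim_mx A C)%MS.
have MP (v : 'rV_n) : (v <= M)%MS = (v <= V)%MS && (v *m A <= C)%MS.
  by rewrite sub_capmx sub_preim.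
have modM : mxmodule rG M.
  apply/mxmoduleP => x Gx; apply/row_subP => i; rewrite row_mul.
  have := row_sub i M; rewrite !MP => /andP[sv sC].
  by rewrite homA // !mxmodule_trans.
have MPv : forall v : 'rV_n, (v <= M)%MS -> P v.
  apply: ess => //; first exact: capmxSl.
  move=> v; rewrite MP => /andP[sv sC] sw; apply/(kerA v sv).
  by apply/eqP; rewrite -submx0 -UC0 sub_capmx WA.
move/negP: nVW; apply; apply/row_subP => i.
move: (row i V) (row_sub i V) => v sv.
have /sub_addsmxP[[a b] /= vE] : (v *m A <= U + C)%MS by rewrite defE submx1.
have [w sw aE] := UW (a *m U) (submxMl _ _).
have svw : (v - w <= V)%MS by rewrite addmx_sub // eqmx_opp (submx_trans sw).
have Pvw : P (v - w).
  by apply: MPv; rewrite MP svw mulmxBl vE -aE addrC addKr submxMl.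
by rewrite -(subrK w v) addmx_sub // PW.
Qed.

End Sections.

Section Restrict.

Variables (F : fieldType) (n : nat).

Lemma res_module d p (rM : mx_representation F [set: 'S_n.+1] d) (V : 'M_(p, d)) :
  mxmodule rM V -> mxmodule (res_mod rM) V.
Proof.
by move=> /mxmoduleP modV; apply/mxmoduleP => x _; apply: modV; rewrite inE.
Qed.

Lemma res_section d p (rG : mx_representation F [set: 'S_n.+1] d) (V : 'M_(p, d)) P
    e (rH : mx_representation F [set: 'S_n.+1] e) :
  is_section rG V P rH -> is_section (res_mod rG) V P (res_mod rH).
Proof.
move=> [modV [A [homA kerA surA]]]; split; first exact: res_module.
by exists A; split=> // x _ v sv; apply: homA; rewrite ?inE.
Qed.

Lemma res_rsim d1 d2 (r1 : mx_representation F [set: 'S_n.+1] d1)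
    (r2 : mx_representation F [set: 'S_n.+1] d2) :
  mx_rsim r1 r2 -> mx_rsim (res_mod r1) (res_mod r2).
Proof. by case=> B e fB homB; exists B => // x _; apply: homB; rewrite inE. Qed.

End Restrict.

(** * Identification of the homology modules *)

Section Assembly.

Variable F : fieldType.
Hypothesis charF : 2%N \in [pchar F].

Lemma section_homology n k : is_section (perm_mod n F k) (ker_eps n F k)
  (fun v => (v <= im_eps n F k)%MS) (homology_mod n F k).
Proof. exact: is_section_repr. Qed.

Lemma section_D n (k : nat) : is_section (perm_mod n F k) (Specht n F k)
  (fun v => (v <= Specht n F k :&: orth (Specht n F k))%MS) (D_mod n F k).
Proof. exact: is_section_repr. Qed.

Lemma Specht_cycle n (k : nat) (v : 'rV_#|Omega n k|) : (k.*2 <= n)%N ->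
  (v <= Specht n F k)%MS ->
  del (enum 'I_n) (phi v) = 0 /\ eps (enum 'I_n) (phi v) = 0.
Proof.
move=> kn; pose W (f : {ffun {set 'I_n} -> F^o}) :=
  del (enum 'I_n) f = 0 /\ eps (enum 'I_n) f = 0.
apply: (Specht_ind charF (W := W)) => // [|ps ups _].
  split=> [|c f g [df ef] [dg eg]]; rewrite /W ?linear0 //.
  by rewrite !linearP /= df ef dg eg scaler0 addr0.
by rewrite /W del_Prod ?eps_Prod.
Qed.

Lemma Specht_sub_perp n (k : nat) (v : 'rV_#|Omega n k|) : (k.*2 <= n)%N ->
  (v <= Specht n F k)%MS ->
  (v <= Specht n F k :&: orth (Specht n F k))%MS <-> perp (enum 'I_n) k (phi v).
Proof. by move=> kn sv; rewrite sub_capmx sv /= sub_orth_Specht. Qed.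

Lemma eps_vform n s k (f : {ffun {set 'I_n} -> F^o}) : vform s k f ->
  eps (enum 'I_n) f = 0.
Proof.
case: k => [->|k [b [ps [/= /andP[nb ups] _ _ ->]]]]; first exact: eps_one.
by rewrite epsF_xm ?supp_Prod // eps_Prod // del_Prod // linear0 addr0.
Qed.

Lemma Prod_not_perp n a ps : uniq (a :: flat ps) ->
  ~ perp (enum 'I_n) (size ps) (Prod F ps).
Proof.
move=> u pP; have [ps' [sz' u' _ e]] := path_pairs charF u.
have := pP ps' u' _ sz'; rewrite e => z.
by have /eqP := z (fun x _ => mem_enum _ x); rewrite oner_eq0.
Qed.

Lemma homology_zero n k : (k + k + 1 < n%:Z) || (n%:Z + 1 < k + k) ->
  mx_rsim (homology_mod n F k) (zero_mod F [set: 'S_n]).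
Proof.
move=> far; apply: (is_section_rsim (section_homology n k)).
  by apply: is_section_zero; apply: ker_eps_module.
move=> v /(sub_ker_eps charF) Ev; split=> // _; apply/(sub_im_eps charF).
apply: bounds_far => //; [exact: enum_uniq | exact: supp_enum | exact: homog_phi |].
by rewrite size_enum_ord.
Qed.

Lemma odd_perp_iff m (v : 'rV[F]_#|Omega m.*2.+1 m|) :
  eps (enum 'I_m.*2.+1) (phi v) = 0 ->
  bounds (enum 'I_m.*2.+1) m (phi v) <-> perp (enum 'I_m.*2.+1) m (phi v).
Proof.
move=> Ev; split; first by apply: perp_bounds; rewrite ?enum_uniq ?size_enum_ord.
by apply: bounds_perp; rewrite ?enum_uniq ?size_enum_ord //; [apply: supp_enum | apply: homog_phi].
Qed.

Lemma odd_span_Specht m (w : 'rV[F]_#|Omega m.*2.+1 m|) :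
  (w <= ker_eps m.*2.+1 F m)%MS ->
  exists2 v : 'rV_#|Omega m.*2.+1 m|, (v <= Specht m.*2.+1 F m)%MS &
    (w - v <= im_eps m.*2.+1 F m)%MS.
Proof.
move=> /(sub_ker_eps charF) Ew.
suff: (w <= Specht m.*2.+1 F m + im_eps m.*2.+1 F m)%MS.
  case/sub_addsmxP => [[a b] /= ->]; exists (a *m Specht m.*2.+1 F m); first exact: submxMl.
  by rewrite addrC addKr submxMl.
rewrite -(phiK w); move: (phi w) Ew (@homog_phi _ _ _ w) => f Ef hf.
apply: (span_Prod charF (enum_uniq _) _ (@supp_enum _ _ f) hf Ef (row_pred_closed _)).
- by rewrite size_enum_ord.
- move=> ps ups _ szps; apply: submx_trans (addsmxSl _ _).
  by apply: Prod_in_Specht => //; lia.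
move=> h _ hh; apply: submx_trans (addsmxSr _ _); apply/(sub_im_eps charF).
by rewrite psiK; [exists h; split=> //; apply: supp_enum | apply: homog_eps hh; lia].
Qed.

(** The inclusion of the Specht module into the cycles is onto modulo boundaries by
    [odd_span_Specht], and the boundaries it contains form its radical by [odd_perp_iff]. *)
Lemma homology_odd m : mx_rsim (homology_mod m.*2.+1 F m) (D_mod m.*2.+1 F m).
Proof.
have le : (m.*2 <= m.*2.+1)%N by [].
have S1 : is_section (perm_mod m.*2.+1 F m) (Specht m.*2.+1 F m)
    (fun v => (v *m 1%:M <= im_eps m.*2.+1 F m)%MS) (homology_mod m.*2.+1 F m).
  apply: (is_section_preim (section_homology _ _) (Specht_module _ _ _)) => [x _ v _|v sv|w sw].
  - by rewrite !mulmx1.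
  - by rewrite mulmx1; apply/(sub_ker_eps charF); apply: (Specht_cycle le sv).2.
  - by have [v sv swv] := odd_span_Specht sw; exists v => //; rewrite mulmx1.
apply: (is_section_rsim S1 (section_D _ _)) => v sv.
rewrite mulmx1 (sub_im_eps charF) (Specht_sub_perp le sv).
by apply: odd_perp_iff; apply: (Specht_cycle le sv).2.
Qed.

(** Induced by the one-step boundary, a chain map because it commutes with the two-step one. *)
Lemma homology_odd_succ m :
  mx_rsim (homology_mod m.*2.+1 F m.+1) (homology_mod m.*2.+1 F m).
Proof.
set n := m.*2.+1; have e : m.+1%:Z = m%:Z + 1 by lia.
have szn : size (enum 'I_n) = n by rewrite size_enum_ord.
have S1 : is_section (perm_mod n F m.+1) (ker_eps n F m.+1)
    (fun v => (v *m incl_mx n F m.+1 m <= im_eps n F m)%MS) (homology_mod n F m).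
  apply: (is_section_preim (section_homology _ _) (ker_eps_module _ _ _)) => [x _ v _|v|w].
  - by rewrite -!mulmxA incl_mx_hom.
  - move/(sub_ker_eps charF) => Ev; apply/(sub_ker_eps charF).
    by rewrite phi_del // -del_eps Ev linear0.
  move/(sub_ker_eps charF) => Ew.
  have [g [sg hg Eg bg]] := del_surj charF (enum_uniq _) szn (@supp_enum _ _ _) (@homog_phi _ _ _ w) Ew.
  exists (psi m.+1 g).
    by apply/(sub_ker_eps charF); rewrite psiK // e.
  apply/(sub_im_eps charF); rewrite linearB /= phi_del // psiK ?e //.
  by rewrite (subv2 charF) addrC.
apply: (is_section_rsim (section_homology _ _) S1) => v /(sub_ker_eps charF) Ev.
rewrite !(sub_im_eps charF) phi_del //; split=> [[h [_ hh ->]]|].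
  rewrite del_eps; exists (del (enum 'I_n) h); split=> //; first exact: supp_enum.
  by apply: homog_del hh; lia.
move: (phi v) Ev (@homog_phi _ _ _ v) => f Ef; rewrite e => hf.
by apply: del_inj => //; [exact: enum_uniq | exact: supp_enum].
Qed.

(** The symmetric group is transitive on the v-forms, and by [span_vform] they span the cycles
    modulo boundaries. *)
Lemma homology_cyclic n m : n = m.*2 \/ n = m.*2.+1 ->
  (homology_sub n F m == cyclic_mx (coker_eps_mod n F m)
    (in_factmod (im_eps n F m) (v_vec n F m)))%MS.
Proof.
move=> nm; have mn : (m.*2 <= n)%N by case: nm => ->.
set C := cyclic_mx _ _; have modC : mxmodule (coker_eps_mod n F m) C by apply: cyclic_mx_module.
have imE (u : 'rV_#|Omega n m|) : (u <= im_eps n F m)%MS -> in_factmod (im_eps n F m) u = 0.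
  by rewrite -in_factmod_eq0 => /eqP.
apply/andP; split; last first.
  apply: cyclic_mx_sub; first by apply: section_module; apply: ker_eps_module.
  rewrite genmxE; apply: submxMr; apply/(sub_ker_eps charF).
  exact: eps_vform (phi_v charF mn).
rewrite genmxE; apply/row_subP => i; rewrite row_mul.
have /(sub_ker_eps charF) := row_sub i (ker_eps n F m); move: (row i _) => u Eu.
rewrite -/(in_factmod (im_eps n F m) u) -(phiK u).
move: (phi u) Eu (@homog_phi _ _ _ u) => f Ef hf.
pose W f := (in_factmod (im_eps n F m) (psi m f) <= C)%MS.
apply: (span_vform charF (W := W) (enum_uniq _) _ (@supp_enum _ _ f) hf Ef).
- by rewrite size_enum_ord.
- by split=> [|c g h Wg Wh]; rewrite /W ?linear0 ?sub0mx // !linearP addmx_sub // scalemx_sub.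
- move=> g vg; have [t <-] := vform_permute charF mn vg.
  rewrite /W -psi_perm; last exact: homog_phi.
  rewrite phiK (in_factmodJ (im_eps_module n F m)) ?inE //.
  by apply: (mxmodule_trans modC); rewrite ?inE // cyclic_mx_id.
move=> h _ hh; rewrite /W imE ?sub0mx //; apply/(sub_im_eps charF).
by rewrite psiK; [exists h; split=> //; apply: supp_enum | apply: homog_eps hh; lia].
Qed.

(** Induced by [incl]; the obstructions to bijectivity are homology classes in degrees m - 1 and m +
    1 on 2m points, where there are none. *)
Lemma res_homology m :
  mx_rsim (res_mod (homology_mod m.*2.+1 F m)) (homology_mod m.*2 F m).
Proof.
pose B := lin1_mx (psi m \o (@incl F m.*2) \o @phi F m.*2 m).
have BE (v : 'rV_#|Omega m.*2 m|) : phi (v *m B) = incl (phi v).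
  by rewrite mul_rV_lin1 /= psiK //; apply: homog_incl; apply: homog_phi.
have S1 : is_section (perm_mod m.*2 F m) (ker_eps m.*2 F m)
    (fun v => (v *m B <= im_eps m.*2.+1 F m)%MS) (res_mod (homology_mod m.*2.+1 F m)).
  apply: (is_section_preim (res_section (section_homology _ _)) (ker_eps_module _ _ _)).
  - by move=> x _ v _; apply: phi_inj; rewrite BE !phi_perm // BE incl_permute.
  - move=> v /(sub_ker_eps charF) Ev; apply/(sub_ker_eps charF).
    by rewrite BE -incl_epsF Ev linear0.
  move=> w /(sub_ker_eps charF) Ew.
  have [||f [sf hf Ef [h [_ hh hE]]]] := cycle_restrict charF (uniq_ups _) (top_notin_ups _) _ (@homog_phi _ _ _ w) Ew.
  - by move=> a; rewrite -(perm_mem (perm_top _)) mem_enum.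
  - by rewrite size_ups; lia.
  have fr : incl (rest f) = f by apply: restK; apply: sf; apply: top_notin_ups.
  have hr := homog_rest hf.
  exists (psi m (rest f)).
    by apply/(sub_ker_eps charF); rewrite psiK // -rest_epsF // Ef linear0.
  apply/(sub_im_eps charF); rewrite linearB /= BE psiK // fr.
  exists h; split=> //; first exact: supp_enum.
  by rewrite -hE (subv2 charF).
apply: (is_section_rsim S1 (section_homology _ _)) => v /(sub_ker_eps charF) Ev.
rewrite !(sub_im_eps charF) BE -(bounds_incl m (phi v)); split=> [[h [sh hh e]]|[h [sh hh e]]].
  apply: (bounds_restrict charF (a := ord_max)); rewrite ?uniq_ups ?top_notin_ups ?size_ups //.
  - exact: supp_incl.
  - by lia.
  exists h; split=> // a; by rewrite -(perm_mem (perm_top _)) mem_enum.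
by exists h; split=> //; apply: supp_enum.
Qed.

End Assembly.

(** * The middle homology on an even number of points *)

Section EvenCase.

Variable F : fieldType.
Hypothesis charF : 2%N \in [pchar F].
Variable p : nat.

Local Notation n := (p.*2.+2).
Local Notation T := 'I_n.
Local Notation Lam := {ffun {set T} -> F^o}.
Local Notation D := (@del F T (enum T)).
Local Notation E := (@eps F T (enum T)).
Local Notation top := (@ord_max p.*2.+1).
Local Notation pts := (ups p.*2.+1).

Let p2n : (p.*2 <= n)%N. Proof. by lia. Qed.
Let p2n1 : (p.+1.*2 <= n)%N. Proof. by lia. Qed.
Let p2n' : (p.*2 <= p.*2.+1)%N. Proof. by lia. Qed.
Let perm_full : perm_eq (enum T) (top :: pts). Proof. exact: perm_top. Qed.
Let size_pts : size pts = p.*2.+1. Proof. exact: size_ups. Qed.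

Lemma rest_co0 (y : Lam) : rest (co0 top y) = rest y.
Proof. by rewrite [in RHS](co0E top y) linearD /= rest_xm_top addr0. Qed.

Lemma incl_rest_co0 (y : Lam) : incl (rest y) = co0 top y.
Proof. by rewrite -rest_co0 restK // pd_co0. Qed.

Lemma co0_cycle (y : Lam) : D y = 0 -> E y = 0 -> E (co0 top y) = 0.
Proof.
move=> Dy Ey; have := eps_co0 charF top y; rewrite Ey linear0 -pd_del Dy linear0 addr0.
by move=> <-.
Qed.

(** Setting the last variable to zero maps the Specht module to cycles on 2p + 1 points, onto modulo
    boundaries. Its elements sent to boundaries are those of the radical, by [perp_co0] in one
    direction and by [boundary_of_co0] with [perp_boundary] in the other. *)
Lemma res_D_even : mx_rsim (res_mod (D_mod n F p)) (D_mod p.*2.+1 F p).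
Proof.
apply: mx_rsim_trans (homology_odd charF p).
pose B := lin1_mx (psi p \o (@rest F p.*2.+1) \o @phi F n p).
have BE (v : 'rV_#|Omega n p|) : phi (v *m B) = rest (phi v).
  by rewrite mul_rV_lin1 /= psiK //; apply: homog_rest; apply: homog_phi.
have S1 : is_section (res_mod (perm_mod n F p)) (Specht n F p)
    (fun v => (v *m B <= im_eps p.*2.+1 F p)%MS) (homology_mod p.*2.+1 F p).
  apply: (is_section_preim (section_homology _ _ _) (res_module (Specht_module _ _ _))).
  - by move=> x _ v _; apply: phi_inj; rewrite BE !phi_perm // BE -rest_permute.
  - move=> v sv; have [Dv Ev] := Specht_cycle charF p2n sv.
    apply/(sub_ker_eps charF); rewrite BE -rest_co0 -rest_epsF.
      by rewrite co0_cycle // linear0.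
    by apply: (@supp_of_pd0 _ _ top); [move=> a; rewrite -(perm_mem perm_full) mem_enum | apply: pd_co0].
  move=> w sw; have [u su wu] := odd_span_Specht charF sw.
  suff [v sv vE] : exists2 v : 'rV_#|Omega n p|, (v <= Specht n F p)%MS & v *m B = u.
    by exists v; rewrite // vE.
  suff: (u <= Specht n F p *m B)%MS.
    by case/submxP => C ->; exists (C *m Specht n F p); rewrite ?submxMl ?mulmxA.
  rewrite -(phiK u); apply: (Specht_ind charF p2n' (row_pred_closed _) _ su) => ps u_ps sz.
  have -> : psi p (Prod F ps) = psi p (Prod F [seq (lift top q.1, lift top q.2) | q <- ps]) *m B.
    apply: phi_inj; rewrite BE !psiK ?rest_Prod //; apply: homog_Prod; rewrite ?size_map sz //.
  apply: submxMr; apply: Prod_in_Specht => //; last by rewrite size_map.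
  by rewrite flat_up map_inj_uniq //; apply: lift_inj.
apply: (is_section_rsim (res_section (section_D _ _ _)) S1) => v sv.
have [Dv Ev] := Specht_cycle charF p2n sv.
rewrite (Specht_sub_perp charF p2n sv) (sub_im_eps charF) BE -(bounds_incl p (rest (phi v))).
rewrite incl_rest_co0; split.
  by apply: (perp_co0 charF perm_full size_pts) => //; apply: homog_phi.
case/(boundary_of_co0 charF perm_full size_pts Dv) => G [_ -> DG].
exact: (perp_boundary charF perm_full size_pts).
Qed.

(* The submodule of the homology in the middle degree which is isomorphic to
   D^(p+2,p). *)
Definition mid_sub : 'M[F]_#|Omega n p.+1| := (Specht n F p.+1 + im_eps n F p.+1)%MS.

Lemma mid_sub_module : mxmodule (perm_mod n F p.+1) mid_sub.
Proof. by apply: addsmx_module; [apply: Specht_module | apply: im_eps_module]. Qed.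

Lemma mid_sub_ker : (mid_sub <= ker_eps n F p.+1)%MS.
Proof.
rewrite addsmx_sub sub_im_ker_eps // andbT; apply/row_subP => i.
by apply/(sub_ker_eps charF); apply: (Specht_cycle charF p2n1 (row_sub i _)).2.
Qed.

Lemma psi_im_eps k h : homog (k + 2) h -> (psi k (E h) <= im_eps n F k)%MS.
Proof.
move=> hh; apply/(sub_im_eps charF); rewrite psiK; last by apply: homog_eps hh; lia.
by exists h; split=> //; apply: supp_enum.
Qed.

Lemma mid_sub_eq (v : 'rV_#|Omega n p.+1|) : (v <= mid_sub)%MS ->
  exists s h, [/\ (s <= Specht n F p.+1)%MS, homog (p.+1%:Z + 2) h
    & phi v = phi s + E h].
Proof.
case/sub_addsmxP => [[a b] /= ->].
have /(sub_im_eps charF)[h [_ hh e]] := submxMl b (im_eps n F p.+1).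
by exists (a *m Specht n F p.+1), h; rewrite submxMl linearD /= e.
Qed.

Lemma split_pair (ps : seq (T * T)) : uniq (flat ps) -> size ps = p ->
  exists a b, [/\ uniq (flat ((a, b) :: ps)), a != b, pd a (Prod F ps) = 0
    & pd b (Prod F ps) = 0].
Proof.
move=> u sz; have [a [b pr]] := two_rest charF perm_full size_pts u sz.
have : uniq ([:: a; b] ++ flat ps) by rewrite -(perm_uniq (permEl (perm_catC _ _))) -(perm_uniq pr) enum_uniq.
move=> /= uab; exists a, b; split=> //; move: uab; rewrite inE negb_or -andbA => /and4P[nab na nb _] //.
  exact: supp_Prod.
exact: supp_Prod.
Qed.

Let e2 : p.+2%:Z = p%:Z + 2. Proof. by lia. Qed.
Let e1 : p.+2%:Z = p.+1%:Z + 1. Proof. by lia. Qed.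
Let e0 : p.+1%:Z = p%:Z + 1. Proof. by lia. Qed.

(** The correspondence E g -> D g is realised by a common source V in degree p + 2 that maps to both
    sides; [perp_eps_iff] says that the kernels agree. The element x_a x_b P goes to P on one side
    and to (x_a + x_b) P on the other, which gives surjectivity. *)
Lemma mid_sub_section (d : nat) (r : mx_representation F [set: 'S_n] d) :
  is_section (perm_mod n F p.+1) mid_sub (fun v => (v <= im_eps n F p.+1)%MS) r ->
  mx_rsim r (D_mod n F p).
Proof.
move=> secr.
pose B2 := incl_mx n F p.+2 p; pose B1 := incl_mx n F p.+2 p.+1.
pose V := (preim_mx B2 (Specht n F p) :&: preim_mx B1 mid_sub)%MS.
have VP (v : 'rV_#|Omega n p.+2|) :
    (v <= V)%MS = (v *m B2 <= Specht n F p)%MS && (v *m B1 <= mid_sub)%MS.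
  by rewrite sub_capmx !sub_preim.
have modV : mxmodule (perm_mod n F p.+2) V.
  apply: capmx_module.
    by apply: preim_module (Specht_module _ _ _) => x _; apply: incl_mx_hom.
  by apply: preim_module mid_sub_module => x _; apply: incl_mx_hom.
have lift_pair (ps : seq (T * T)) a b : uniq (flat ps) -> size ps = p ->
    uniq (flat ((a, b) :: ps)) -> a != b ->
    pd a (Prod F ps) = 0 -> pd b (Prod F ps) = 0 ->
  exists2 g : 'rV_#|Omega n p.+2|, (g <= V)%MS &
    g *m B2 = psi p (Prod F ps) /\ g *m B1 = psi p.+1 (Prod F ((a, b) :: ps)).
  move=> u sz uab nab a0 b0; pose g := psi p.+2 (xm a (xm b (Prod F ps))).
  have hg : homog p.+2 (xm a (xm b (Prod F ps))).
    apply: (@homog_xm _ _ _ p.+1); first lia.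
    by apply: (@homog_xm _ _ _ p); [lia | apply: homog_Prod; rewrite sz].
  have g2 : g *m B2 = psi p (Prod F ps).
    apply: phi_inj; rewrite phi_eps // !psiK //; last by apply: homog_Prod; rewrite sz.
    by rewrite epsF_xm2 // eps_Prod // del_Prod // !(linear0, add0r).
  have g1 : g *m B1 = psi p.+1 (Prod F ((a, b) :: ps)).
    apply: phi_inj; rewrite phi_del // !psiK //; last by apply: homog_Prod; rewrite /= sz.
    by rewrite !delF_xm // del_Prod // !(linear0, add0r).
  exists g => //; rewrite VP g1 g2 Prod_in_Specht //.
  by apply: submx_trans (addsmxSl _ _); apply: Prod_in_Specht => //=; rewrite sz.
have S2 : is_section (perm_mod n F p.+2) V
    (fun v => (v *m B2 <= Specht n F p :&: orth (Specht n F p))%MS) (D_mod n F p).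
  apply: (is_section_preim (section_D _ _ _) modV) => [x _ v _|v|w sw].
  - by rewrite -!mulmxA incl_mx_hom.
  - by rewrite VP => /andP[].
  suff: (w <= V *m B2)%MS.
    case/submxP => C ->; exists (C *m V); first exact: submxMl.
    by rewrite mulmxA subrr sub0mx.
  rewrite -(phiK w); apply: (Specht_ind charF p2n (row_pred_closed _) _ sw) => ps u sz.
  have [a [b [uab nab a0 b0]]] := split_pair u sz.
  have [g sg [<- _]] := lift_pair ps a b u sz uab nab a0 b0.
  exact: submxMr.
have S1 : is_section (perm_mod n F p.+2) V
    (fun v => (v *m B1 <= im_eps n F p.+1)%MS) r.
  apply: (is_section_preim secr modV) => [x _ v _|v|w /mid_sub_eq[v [h [sv hh wE]]]].
  - by rewrite -!mulmxA incl_mx_hom.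
  - by rewrite VP => /andP[].
  have : (v <= V *m B1)%MS.
    rewrite -(phiK v); apply: (Specht_ind charF p2n1 (row_pred_closed _) _ sv) => -[|[a b] ps] // u [sz].
    move: (u) => /= /and3P[]; rewrite inE negb_or => /andP[nab na] nb ups.
    have [||g sg [_ <-]] := lift_pair ps a b ups sz u nab.
    + exact: supp_Prod.
    + exact: supp_Prod.
    exact: submxMr.
  case/submxP => C vE; exists (C *m V); first exact: submxMl.
  rewrite -mulmxA -vE -[w]phiK wE linearD /= phiK addrC addKr.
  exact: psi_im_eps.
apply: (is_section_rsim S1 S2) => v; rewrite VP => /andP[s2 s1].
have [D2 E2] := Specht_cycle charF p2n s2.
rewrite (Specht_sub_perp charF p2n s2) (sub_im_eps charF).
have gE : phi (v *m B2) = E (phi v) by apply: phi_eps.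
have gD : phi (v *m B1) = D (phi v) by apply: phi_del.
rewrite gE gD e0 in D2 *.
move: (phi v) (@homog_phi _ _ _ v) D2 => g; rewrite e2 => hg Dg.
by apply: iff_sym; apply: (perp_eps_iff charF perm_full size_pts).
Qed.

(** [D] sends x_b P to P, hence maps V onto the Specht module in degree p. By [perp_boundary] and
    [perp_del_span], an element of V goes to the radical exactly when it lies in [mid_sub]. *)
Lemma mid_quo_section (d : nat) (r : mx_representation F [set: 'S_n] d) :
  is_section (perm_mod n F p.+1) (ker_eps n F p.+1) (fun v => (v <= mid_sub)%MS) r ->
  mx_rsim r (D_mod n F p).
Proof.
move=> secr; pose B := incl_mx n F p.+1 p.
pose V := (ker_eps n F p.+1 :&: preim_mx B (Specht n F p))%MS.
have VP (v : 'rV_#|Omega n p.+1|) :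
    (v <= V)%MS = (v <= ker_eps n F p.+1)%MS && (v *m B <= Specht n F p)%MS.
  by rewrite sub_capmx sub_preim.
have modV : mxmodule (perm_mod n F p.+1) V.
  apply: capmx_module; first exact: ker_eps_module.
  by apply: preim_module (Specht_module _ _ _) => x _; apply: incl_mx_hom.
have v_in_V b ps : uniq (b :: flat ps) -> size ps = p ->
    (psi p.+1 (xm b (Prod F ps)) <= V)%MS /\
    psi p.+1 (xm b (Prod F ps)) *m B = psi p (Prod F ps).
  move=> u sz; have hf : homog p.+1 (xm b (Prod F ps)).
    by apply: (@homog_xm _ _ _ p); [lia | apply: homog_Prod; rewrite sz].
  move: (u) => /= /andP[nb ups].
  have fB : psi p.+1 (xm b (Prod F ps)) *m B = psi p (Prod F ps).
    apply: phi_inj; rewrite phi_del // !psiK //; last by apply: homog_Prod; rewrite sz.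
    by rewrite delF_xm // del_Prod // linear0 add0r.
  split=> //; rewrite VP fB Prod_in_Specht // andbT; apply/(sub_ker_eps charF).
  rewrite psiK //; apply: (@eps_vform _ charF _ (enum T) p.+1); exists b, ps; split=> // x.
  by rewrite mem_enum.
have S2 : is_section (perm_mod n F p.+1) V
    (fun v => (v *m B <= Specht n F p :&: orth (Specht n F p))%MS) (D_mod n F p).
  apply: (is_section_preim (section_D _ _ _) modV) => [x _ v _|v|w sw].
  - by rewrite -!mulmxA incl_mx_hom.
  - by rewrite VP => /andP[].
  suff: (w <= V *m B)%MS.
    case/submxP => C ->; exists (C *m V); first exact: submxMl.
    by rewrite mulmxA subrr sub0mx.
  rewrite -(phiK w); apply: (Specht_ind charF p2n (row_pred_closed _) _ sw) => ps u sz.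
  have [a [b [uab nab a0 b0]]] := split_pair u sz.
  have [|sf <-] := v_in_V b ps _ sz; last exact: submxMr.
  by move: uab => /= /andP[].
have S1 : is_section (perm_mod n F p.+1) V (fun v => (v *m 1%:M <= mid_sub)%MS) r.
  apply: (is_section_preim secr modV) => [x _ v _|v|w].
  - by rewrite !mulmx1.
  - by rewrite mulmx1 VP => /andP[].
  move=> /(sub_ker_eps charF) Ew; suff: (w <= V + mid_sub)%MS.
    case/sub_addsmxP => [[a b] /= ->]; exists (a *m V); first exact: submxMl.
    by rewrite mulmx1 addrC addKr submxMl.
  rewrite -(phiK w); move: (phi w) Ew (@homog_phi _ _ _ w) => f Ef hf.
  apply: (span_vform charF (enum_uniq _) _ (@supp_enum _ _ f) hf Ef (row_pred_closed _)).
  - by rewrite size_enum_ord; left.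
  - move=> g [b [ps [u _ sz ->]]]; apply: submx_trans (addsmxSl _ _).
    by have [] := v_in_V b ps u sz.
  move=> h _ hh; apply: submx_trans (addsmxSr _ _); apply: submx_trans (addsmxSr _ _).
  exact: psi_im_eps.
apply: (is_section_rsim S1 S2) => v; rewrite VP mulmx1 => /andP[/(sub_ker_eps charF) Ev sB].
rewrite (Specht_sub_perp charF p2n sB) phi_del //; split=> [|pv].
  case/mid_sub_eq => s [h [ss hh ->]]; have [Ds _] := Specht_cycle charF p2n1 ss.
  rewrite linearD /= Ds add0r del_eps; apply: (perp_boundary charF perm_full size_pts).
  exact: delF2.
rewrite -(phiK v); move: (phi v) (@homog_phi _ _ _ v) Ev pv => f; rewrite {1}e0 => hf Ef pf.
apply: (perp_del_span charF perm_full size_pts hf Ef pf (row_pred_closed _)).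
  move=> ps u sz; apply: submx_trans (addsmxSl _ _).
  exact: Prod_in_Specht.
move=> h _; rewrite -e0 => hh; apply: submx_trans (addsmxSr _ _).
exact: psi_im_eps.
Qed.

(** If P is the product without the pair (a, b), then x_a x_b P is sent to P by [E] and to the whole
    product by [D]. By [perp_eps_iff] a bounding product would make P orthogonal to all
    polytabloids, which the spare point [a] excludes. *)
Lemma Prod_not_bounds (ps : seq (T * T)) : uniq (flat ps) -> size ps = p.+1 ->
  ~ bounds (enum T) p.+1 (Prod F ps).
Proof.
case: ps => [|[a b] ps] // u [sz] bP.
move: (u) => /= /and3P[]; rewrite inE negb_or => /andP[nab na] nb ups.
have [a0 b0] : pd a (Prod F ps) = 0 /\ pd b (Prod F ps) = 0 by split; apply: supp_Prod.
have gE : E (xm a (xm b (Prod F ps))) = Prod F ps.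
  by rewrite epsF_xm2 // eps_Prod // del_Prod // !(linear0, add0r).
have gD : D (xm a (xm b (Prod F ps))) = Prod F ((a, b) :: ps).
  by rewrite !delF_xm // del_Prod // !(linear0, add0r).
apply: (@Prod_not_perp _ charF _ a ps); first by rewrite /= na.
rewrite sz -gE; apply/(perp_eps_iff charF perm_full size_pts).
- apply: (@homog_xm _ _ _ (p%:Z + 1)); first lia.
  by apply: (@homog_xm _ _ _ p); [lia | apply: homog_Prod; rewrite sz].
- by rewrite gE del_Prod.
by rewrite gD -e0.
Qed.

Lemma homology_nonsplit :
  nonsplit_extension (homology_mod n F p.+1) (D_mod n F p) (D_mod n F p).
Proof.
have im_mid : (im_eps n F p.+1 <= mid_sub)%MS by apply: addsmxSr.
have secA := is_section_repr (im_eps_module n F p.+1) mid_sub_module.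
have secB := is_section_repr mid_sub_module (ker_eps_module n F p.+1).
apply: (nonsplit_section (section_homology _ _ _) mid_sub_module mid_sub_ker _
  (is_section_trans secA (mid_sub_section secA))
  (is_section_trans secB (mid_quo_section secB))).
- by move=> v _ sv; apply: submx_trans im_mid.
(* The vector x_b P is a cycle outside [mid_sub]: otherwise P = D (x_b P) would be E (D h), hence
   orthogonal to all polytabloids. *)
- apply/negP => sub; have vv := phi_v charF p2n1.
  have : (v_vec n F p.+1 <= mid_sub)%MS.
    apply: submx_trans sub; apply/(sub_ker_eps charF).
    exact: eps_vform vv.
  case/mid_sub_eq => s [h [ss hh vE]]; case: vv => b [ps [u _ sz vE']].
  have [Ds _] := Specht_cycle charF p2n1 ss.
  move: (u) => /= /andP[nb ups].
  apply: (@Prod_not_perp _ charF _ b ps) => //; rewrite sz.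
  have -> : Prod F ps = E (D h).
    have := congr1 D vE; rewrite vE' delF_xm // del_Prod // linear0 add0r => ->.
    by rewrite linearD /= Ds add0r del_eps.
  by apply: (perp_boundary charF perm_full size_pts); apply: delF2.
(* Essentiality: were v not a boundary, [socle] would give a polytabloid in M modulo boundaries; it
   lies in [mid_sub] and does not bound. *)
move=> M modM sM dis v sv; apply/(sub_im_eps charF).
have /(sub_ker_eps charF) Ev := submx_trans sv sM.
pose N := (M + im_eps n F p.+1)%MS.
have modN : mxmodule (perm_mod n F p.+1) N by apply: addsmx_module => //; apply: im_eps_module.
pose W f := homog p.+1 f /\ (psi p.+1 f <= N)%MS.
have [||a b g _ _ [hg sg]|h _ hh||//|[ps [u _ sz [_ sP]]]] :=
    @socle _ _ charF p.+1 (enum T) W (phi v) (enum_uniq _) _ (@supp_enum _ _ _) (@homog_phi _ _ _ v) Ev.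
- by rewrite size_enum_ord; left.
- split=> [|c f g [hf sf] [hg sg]].
    by split; [apply: homog0 | rewrite linear0 sub0mx].
  split; first by apply: homogD => //; apply: homogZ.
  by rewrite linearP addmx_sub // scalemx_sub.
- split; first exact: homog_permute.
  by rewrite -psi_perm //; apply: mxmodule_trans; rewrite ?inE.
- split; first by apply: homog_eps hh; lia.
  by apply: submx_trans (addsmxSr _ _); apply: psi_im_eps.
- split; first exact: homog_phi.
  by rewrite phiK; apply: submx_trans sv (addsmxSl _ _).
have hP : homog p.+1 (Prod F ps) by apply: homog_Prod; rewrite sz.
case: (@Prod_not_bounds ps u sz); rewrite -(psiK hP); apply/(sub_im_eps charF).
have /sub_addsmxP[[c e] /= PE] := sP.
rewrite PE addmx_sub ?submxMl //; apply: dis; first exact: submxMl.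
have -> : c *m M = psi p.+1 (Prod F ps) - e *m im_eps n F p.+1 by rewrite PE addrK.
rewrite addmx_sub //; last by rewrite eqmx_opp; apply: submx_trans im_mid; apply: submxMl.
by apply: submx_trans (addsmxSl _ _); apply: Prod_in_Specht.
Qed.

End EvenCase.

Theorem theorem1p1 (F : fieldType) (charF : 2%N \in [pchar F]) :
  exists (d : nat -> nat)
         (E : forall m : nat, mx_representation F [set: 'S_(m.*2)] (d m)),
  [/\ forall m : nat, (0 < m)%N ->
        nonsplit_extension (E m) (D_mod m.*2 F m.-1) (D_mod m.*2 F m.-1),
      [/\ forall m : nat, (0 < m)%N ->
            mx_rsim (homology_mod m.*2 F m) (E m),
          forall (m : nat) (k : int), k = m \/ k = m.+1 ->
            mx_rsim (homology_mod m.*2.+1 F k) (D_mod m.*2.+1 F m)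
        & forall (n : nat) (k : int), (0 < n)%N ->
            ~ (exists m : nat, n = m.*2 /\ k = m) ->
            ~ (exists m : nat, n = m.*2.+1 /\ (k = m \/ k = m.+1)) ->
            mx_rsim (homology_mod n F k) (zero_mod F [set: 'S_n])],
      forall n m : nat, (0 < n)%N -> n = m.*2 \/ n = m.*2.+1 ->
        (homology_sub n F m ==
           cyclic_mx (coker_eps_mod n F m)
                     (in_factmod (im_eps n F m) (v_vec n F m)))%MS
    & (forall m : nat, (0 < m)%N ->
         mx_rsim (res_mod (D_mod m.*2.+1 F m)) (E m)) /\
      (* here m = p + 1 *)
      (forall p : nat,
         mx_rsim (res_mod (D_mod p.*2.+2 F p)) (D_mod p.*2.+1 F p))].
Proof.
(* The module [E m] is the middle homology itself, so its isomorphism with the homology is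
   reflexivity and its content is the non-split extension. *)
exists (fun m => \rank (homology_sub m.*2 F m)), (fun m => homology_mod m.*2 F m); split.
- by case=> // p _; apply: homology_nonsplit.
- split.
  + by move=> m _; apply: mx_rsim_refl.
  + move=> m k [->|->]; first exact: homology_odd.
    by apply: mx_rsim_trans (homology_odd charF m); apply: homology_odd_succ.
  move=> n k _ neven nodd; apply: (homology_zero charF).
  (* If neither inequality holds, 2k differs from n by at most 1, and the parity of n puts (n, k)
     into one of the excluded cases. *)
  have [//|far] := boolP (_ || _); exfalso.
  have nE := odd_double_half n; move: far; case on : (odd n) nE => nE far.
    by apply: nodd; exists n./2; split; lia.
  by apply: neven; exists n./2; split; lia.
- by move=> n m _; apply: homology_cyclic.
split=> [m _|p]; last exact: res_D_even.
apply: mx_rsim_trans (res_homology charF m).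
by apply: res_rsim; apply: mx_rsim_sym; apply: homology_odd.
Qed.
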